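(* Let $Y$ be a complete $\mathrm{CAT}(0)$ cube complex, and let $\{G_n\}$ be a sequence of expanders. Then there is no uniform embedding of $\{G_n\}$ into $Y$.
   Context: A cube complex is a metric polyhedral complex in which each cell is isometric to a Euclidean cube $[0,1]^n$ ($n$ may vary), and the gluing maps are isometries. It is a $\mathrm{CAT}(0)$ cube complex if it is a $\mathrm{CAT}(0)$ space. Neither local compactness nor finite dimensionality is assumed. For a finite graph $G=(V,E)$, $\deg(v)$ is the number of edges at $v$, and $\lambda_1(G)$ is the first positive eigenvalue of the combinatorial Laplacian, given variationally by $$\lambda_1(G)=\inf_{\phi}\frac{\sum_{\{u,v\}\in E}|\phi(u)-\phi(v)|^2}{\sum_{v\in V}\deg(v)|\phi(v)-\overline{\phi}|^2},\qquad \overline{\phi}=\sum_{v\in V}\frac{\deg(v)}{2|E|}\phi(v),$$ the infimum being over all nonconstant maps $\phi:V\to\mathbb{R}$. A sequence of expanders is a sequence $\{G_n=(V_n,E_n)\}$ of finite graphs such that (1) $|V_n|\to\infty$ as $n\to\infty$; (2) there is $d$ with $\deg(v)\le d$ for all $v\in V_n$ and all $n$; (3) there is $\lambda>0$ with $\lambda_1(G_n)\ge\lambda$ for all $n$. The graphs are connected, and $G_n$ is regarded as a metric space via the path metric $d_{G_n}$ on its vertex set $V_n$ (each edge having length $1$). Uniform embedding. For a sequence $\{(X_n,d_{X_n})\}$ of metric spaces and a metric space $(Y,d_Y)$, a sequence of maps $f_n:X_n\to Y$ is a uniform embedding if there exist unbounded non-decreasing functions $\rho_1,\rho_2:[0,\infty)\to[0,\infty)$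 such that $$\rho_1(d_{X_n}(x,x'))\le d_Y(f_n(x),f_n(x'))\le\rho_2(d_{X_n}(x,x'))$$ for all $n$ and all $x,x'\in X_n$. *)

(* Defs.v *)
From HB Require Import structures.
From mathcomp Require Import all_boot all_order all_algebra.
From mathcomp Require Import all_classical all_reals all_analysis.

Set Implicit Arguments.
Unset Strict Implicit.
Unset Printing Implicit Defensive.

Import Order.TTheory GRing.Theory Num.Theory.
Import numFieldNormedType.Exports.

Local Open Scope classical_set_scope.
Local Open Scope ring_scope.

(* The library norm on 'rV[R]_n is the sup norm, hence this distance. *)
Definition eucl_dist (R : realType) (n : nat) (x y : 'rV[R]_n) : R :=
  Num.sqrt (\sum_(i < n) (x ord0 i - y ord0 i) ^+ 2).

Definition complete_space (R : realType) (Y : metricType R) : Prop :=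
  forall F : set_system Y, ProperFilter F -> cauchy F ->
    exists y : Y, F --> y.

Section CAT0.
Variables (R : realType) (Y : metricType R).

Definition geodesic (x y : Y) (c : R -> Y) : Prop :=
  [/\ c 0 = x, c (mdist x y) = y &
      forall s t, 0 <= s <= mdist x y -> 0 <= t <= mdist x y ->
        mdist (c s) (c t) = `|s - t|].

Definition geodesic_space : Prop :=
  forall x y : Y, exists c : R -> Y, geodesic x y c.

(* The side c i of the triangle joins v i to v (i + 1), indices mod 3; w is
   the comparison triangle.  The comparison point z in [w i, w (i + 1)] of
   c i s is determined by its distances to the two endpoints. *)
Definition CAT0_inequality : Prop :=
  forall (v : 'I_3 -> Y) (c : 'I_3 -> R -> Y) (w : 'I_3 -> 'rV[R]_2),
    (forall i, geodesic (v i) (v (ordS i)) (c i)) ->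
    (forall i j, eucl_dist (w i) (w j) = mdist (v i) (v j)) ->
    forall (i j : 'I_3) (s t : R) (z z' : 'rV[R]_2),
      0 <= s <= mdist (v i) (v (ordS i)) ->
      0 <= t <= mdist (v j) (v (ordS j)) ->
      eucl_dist (w i) z = s ->
      eucl_dist z (w (ordS i)) = mdist (v i) (v (ordS i)) - s ->
      eucl_dist (w j) z' = t ->
      eucl_dist z' (w (ordS j)) = mdist (v j) (v (ordS j)) - t ->
      mdist (c i s) (c j t) <= eucl_dist z z'.

Definition CAT0_space : Prop := geodesic_space /\ CAT0_inequality.

End CAT0.

Section Cubes.
Variables (R : realType) (n : nat).

Definition cube : set 'rV[R]_n := [set x | forall i, 0 <= x ord0 i <= 1].

(* A face of [0,1]^n fixes the coordinates i with F i = Some b to the value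
   b and leaves the others free. *)
Definition face := 'I_n -> option bool.

Definition face_set (F : face) : set 'rV[R]_n :=
  [set x | cube x /\ forall i b, F i = Some b -> x ord0 i = b%:R].

Definition face_interior (F : face) : set 'rV[R]_n :=
  [set x | forall i,
    if F i is Some b then x ord0 i = b%:R else 0 < x ord0 i < 1].

End Cubes.

Arguments cube {R n}.
Arguments face_set {R n}.
Arguments face_interior {R n}.

Definition isometry_onto (R : realType) (m n : nat)
    (A : set 'rV[R]_m) (B : set 'rV[R]_n) (h : 'rV[R]_m -> 'rV[R]_n) : Prop :=
  h @` A = B /\ forall x y, A x -> A y -> eucl_dist (h x) (h y) = eucl_dist x y.

(* [cell_string p x y l]: some finite sequence of points from x to y, with
   any two successive points in the image of a common cell, has length l,
   each step being measured inside the cell. *)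
Inductive cell_string (R : realType) (Y C : Type) (dim : C -> nat)
    (p : forall a : C, 'rV[R]_(dim a) -> Y) : Y -> Y -> R -> Prop :=
| cell_string_nil x : cell_string p x x 0
| cell_string_cons a u u' y l : cube u -> cube u' ->
    cell_string p (p a u') y l ->
    cell_string p (p a u) y (eucl_dist u u' + l).

(* A polyhedral complex in the sense of Bridson and Haefliger (Chapter I.7)
   all of whose cells are unit cubes: the points are the quotient of the
   disjoint union of the cubes [0,1]^(cell_dim a) by the fibres of [char_map]
   (whose values outside the cubes are irrelevant), and the distance is the
   intrinsic one, assumed here to be a genuine finite metric, as it is in any
   CAT(0) complex.  The infimum over the empty set being +oo, [cc_dist] also
   says that any two points are joined by a string. *)
Record cube_complex (R : realType) := CubeComplex {
  cc_space :> metricType R;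
  cell : Type;
  cell_dim : cell -> nat;
  char_map : forall a : cell, 'rV[R]_(cell_dim a) -> cc_space;
  cc_cover : forall y : cc_space,
    exists (a : cell) (x : 'rV[R]_(cell_dim a)), cube x /\ char_map x = y;
  cc_inj : forall (a : cell) (F : face (cell_dim a)),
    set_inj (face_interior F) (@char_map a);
  cc_glue : forall (a b : cell) (F : face (cell_dim a))
      (G : face (cell_dim b)) (x : 'rV[R]_(cell_dim a))
      (y : 'rV[R]_(cell_dim b)),
    face_interior F x -> face_interior G y -> char_map x = char_map y ->
    exists h : 'rV[R]_(cell_dim a) -> 'rV[R]_(cell_dim b),
      isometry_onto (face_set F) (face_set G) h /\
      forall z, face_set F z -> char_map (h z) = char_map z;
  cc_dist : forall x y : cc_space,
    (mdist x y)%:E =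
      ereal_inf [set l%:E | l in [set l | cell_string char_map x y l]]
}.

Record graph := Graph {
  vert :> finType;
  adj : rel vert;
  adj_sym : symmetric adj;
  adj_irr : irreflexive adj
}.

Definition connected_graph (G : graph) : Prop :=
  forall x y : G, connect (@adj G) x y.

Definition deg (G : graph) (v : G) : nat := #|[pred u | adj v u]|.

Section Laplacian.
Variables (R : realType) (G : graph).

(* Sum over unordered edges of a symmetric function; the double sum counts
   each edge twice. *)
Definition edge_sum (f : G -> G -> R) : R :=
  2^-1 * \sum_(u : G) \sum_(v : G | adj u v) f u v.

Definition num_edges : R := edge_sum (fun _ _ => 1).

Definition wmean (phi : G -> R) : R :=
  \sum_(v : G) (deg v)%:R / (2 * num_edges) * phi v.

Definition rayleigh (phi : G -> R) : R :=
  edge_sum (fun u v => `|phi u - phi v| ^+ 2) /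
  \sum_(v : G) (deg v)%:R * `|phi v - wmean phi| ^+ 2.

(* +oo when G has no nonconstant function, i.e. at most one vertex *)
Definition lambda1 : \bar R :=
  ereal_inf [set (rayleigh phi)%:E | phi in
    [set phi : G -> R | exists u v, phi u <> phi v]].

Definition path_dist (x y : G) : R :=
  inf [set (size s)%:R | s in
    [set s : seq G | path (@adj G) x s /\ last x s = y]].

End Laplacian.

Definition expanders (R : realType) (G : nat -> graph) : Prop :=
  [/\ forall n, connected_graph (G n),
      #|G n| @[n --> \oo] --> \oo,
      exists d : nat, forall n (v : G n), (deg v <= d)%N &
      exists2 lambda : R, 0 < lambda &
        forall n, (lambda%:E <= lambda1 R (G n))%E].

Definition control_function (R : realType) (rho : R -> R) : Prop :=
  [/\ forall t, 0 <= t -> 0 <= rho t,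
      forall s t, 0 <= s -> s <= t -> rho s <= rho t &
      forall M, exists2 t, 0 <= t & M < rho t].

Definition uniform_embedding (R : realType) (X : nat -> Type)
    (dX : forall n, X n -> X n -> R) (Y : metricType R)
    (f : forall n, X n -> Y) : Prop :=
  exists rho1 rho2 : R -> R,
    [/\ control_function rho1, control_function rho2 &
        forall n (x x' : X n),
          rho1 (dX n x x') <= mdist (f n x) (f n x') <= rho2 (dX n x x')].

(* Main.v *)
(* For the degree weights m on the vertices of a graph and f : G -> Y, let p be
   the barycenter of the masses m v at f v, D v = d(p, f v) and M the total mass.
   Near p the complex is a cone over an all-right spherical complex; recording
   the nonnegative coordinates of a point of a cell along the edge germs at p
   maps this cone to a Hilbert space by a 1-Lipschitz map phi preserving the
   distance to the apex.  Going from y to z through the common face of their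
   cells shows <y, z> >= 2 phi(y).phi(z) - |y| |z| for the inner product of
   the tangent cone, and minimality of p makes the m-average of <., z>
   nonpositive.  Hence |sum_v m v phi(v)|^2 <= (sum_v m v D v)^2 / 2, so phi has
   at least half of the second moment of f as variance, and the scalar Poincare
   inequality applied to the coordinates of phi gives
     lambda / 2 * sum_v m v D v^2 <= sum over the edges of d(f u, f v)^2.
   For a uniform embedding of expanders, half of the vertices are then sent
   into a ball of radius independent of n, hence lie in a ball of G_n of
   radius independent of n, whose cardinality is bounded. *)

Require Import Defs.
From mathcomp Require Import all_boot all_order all_algebra.
From mathcomp Require Import all_classical all_reals all_analysis.
From mathcomp Require Import ring lra.

Set Implicit Arguments.
Unset Strict Implicit.
Unset Printing Implicit Defensive.

Import Order.TTheory GRing.Theory Num.Theory.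
Import numFieldNormedType.Exports.

Local Open Scope classical_set_scope.
Local Open Scope ring_scope.

(** * Euclidean distance *)

Section Euclid.
Variables (R : realType) (n : nat).
Implicit Types (x y z : 'rV[R]_n) (t : R).

(** With no bound on dimension and no local finiteness, compactness gives no minimal distance from
    [p] to faces. Its substitute is a number [e] read off one cell: how far the noninteger
    coordinates of [p] stay from 0 and 1. Face isometries only permute and reflect coordinates, so
    [e] serves all cells through [p], and a string from [p] of length below [e] never leaves these
    cells.

    Characteristic maps are only assumed injective on open faces. That whole cells embed
    isometrically is deduced from the CAT(0) inequality: a segment of a cell is essentially a local
    geodesic, hence a geodesic. Uniqueness of geodesics then replaces any description of the
    intersection of two cells.

    Neither the tangent cone nor its Hilbert space is constructed. On the geodesics from [p] to the
    finitely many [f v], points are taken at one scale [T], so small that each shares a cell with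
    [p]; their finitely many edge directions give coordinates in ['rV_N], rescaled by [T^-1] at the
    end. The factor 1/2 is lost because the unfolding makes the normals to the common face opposite,
    the worst case. *)

Definition dot x y : R := \sum_(i < n) x ord0 i * y ord0 i.

Lemma dotC x y : dot x y = dot y x.
Proof. by apply: eq_bigr => i _; rewrite mulrC. Qed.

Lemma dotDl x y z : dot (x + y) z = dot x z + dot y z.
Proof. by rewrite -big_split; apply: eq_bigr => i _; rewrite mxE mulrDl. Qed.

Lemma dotZl t x y : dot (t *: x) y = t * dot x y.
Proof. by rewrite mulr_sumr; apply: eq_bigr => i _; rewrite mxE mulrA. Qed.

Lemma dotNl x y : dot (- x) y = - dot x y.
Proof. by rewrite -scaleN1r dotZl mulN1r. Qed.

Lemma dotDr x y z : dot z (x + y) = dot z x + dot z y.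
Proof. by rewrite dotC dotDl !(dotC z). Qed.

Lemma dotZr t x y : dot x (t *: y) = t * dot x y.
Proof. by rewrite dotC dotZl dotC. Qed.

Lemma dotNr x y : dot x (- y) = - dot x y.
Proof. by rewrite dotC dotNl dotC. Qed.

Lemma dot0l x : dot 0 x = 0.
Proof. by rewrite -(scale0r (0 : 'rV_n)) dotZl mul0r. Qed.

Lemma dot_ge0 x : 0 <= dot x x.
Proof. by apply: sumr_ge0 => i _; rewrite -expr2 sqr_ge0. Qed.

Lemma dot_eq0 x : (dot x x == 0) = (x == 0).
Proof.
apply/idP/eqP => [|->]; last by rewrite dot0l.
rewrite psumr_eq0 => [/allP x0|i _]; last by rewrite -expr2 sqr_ge0.
apply/rowP => i; rewrite mxE; apply/eqP.
by have /= := x0 i (mem_index_enum _); rewrite mulf_eq0 orbb.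
Qed.

Definition dotE := (dotDl, dotDr, dotNl, dotNr, dotZl, dotZr).

Lemma dot_CS x y : dot x y ^+ 2 <= dot x x * dot y y.
Proof.
have [/eqP|x0] := eqVneq (dot x x) 0.
  by rewrite dot_eq0 => /eqP ->; rewrite !dot0l expr0n/= mul0r.
have xp : 0 < dot x x by rewrite lt_def x0 dot_ge0.
have := dot_ge0 (dot x x *: y - dot x y *: x).
rewrite !dotE (dotC y x) => h.
rewrite -subr_ge0 -(pmulr_rge0 _ xp).
apply: le_trans h _; lra.
Qed.

Lemma eucl_distE x y : eucl_dist x y = Num.sqrt (dot (x - y) (x - y)).
Proof.
by congr Num.sqrt; apply: eq_bigr => i _; rewrite !mxE expr2.
Qed.

Lemma eucl_dist_ge0 x y : 0 <= eucl_dist x y.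
Proof. exact: sqrtr_ge0. Qed.

Lemma eucl_dist_sqr x y : eucl_dist x y ^+ 2 = dot (x - y) (x - y).
Proof. by rewrite eucl_distE sqr_sqrtr// dot_ge0. Qed.

Lemma eucl_distC x y : eucl_dist x y = eucl_dist y x.
Proof. by rewrite !eucl_distE -opprB dotNl dotNr opprK. Qed.

Lemma eucl_distxx x : eucl_dist x x = 0.
Proof. by rewrite eucl_distE subrr dot0l sqrtr0. Qed.

Lemma eucl_dist_eq0 x y : (eucl_dist x y == 0) = (x == y).
Proof. by rewrite -sqrf_eq0 eucl_dist_sqr dot_eq0 subr_eq0. Qed.

Lemma eucl_dist_le_sqr x y t : 0 <= t ->
  (eucl_dist x y <= t) = (dot (x - y) (x - y) <= t ^+ 2).
Proof. by move=> t0; rewrite -eucl_dist_sqr ler_sqr ?nnegrE ?eucl_dist_ge0. Qed.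

Lemma eucl_dist_triangle y x z : eucl_dist x z <= eucl_dist x y + eucl_dist y z.
Proof.
rewrite eucl_dist_le_sqr ?addr_ge0 ?eucl_dist_ge0//.
rewrite sqrrD.
have -> : x - z = (x - y) + (y - z) by rewrite addrA subrK.
move: (eucl_dist_sqr x y) (eucl_dist_sqr y z).
move: (x - y) (y - z) => u v hu hv.
have cs : dot u v <= eucl_dist x y * eucl_dist y z.
  apply: le_trans (ler_norm _) _.
  rewrite -ler_sqr ?nnegrE ?mulr_ge0 ?eucl_dist_ge0//.
  by rewrite real_normK ?num_real// exprMn hu hv dot_CS.
rewrite hu hv !dotE (dotC v u) mulr2n; lra.
Qed.

Lemma eucl_dist_scale x y t (z := x + t *: (y - x)) :
  eucl_dist x z = `|t| * eucl_dist x y.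
Proof.
apply/eqP; rewrite -(@eqrXn2 _ 2) ?mulr_ge0 ?eucl_dist_ge0//.
rewrite exprMn !eucl_dist_sqr real_normK ?num_real// /z opprD addrA subrr add0r.
by rewrite -(opprB x y) !dotE; apply/eqP; ring.
Qed.

Lemma eucl_dist_seg x y s t :
  eucl_dist (x + s *: (y - x)) (x + t *: (y - x)) = `|s - t| * eucl_dist x y.
Proof.
rewrite -(eucl_dist_scale x y) !eucl_distE; congr Num.sqrt.
rewrite opprD addrACA subrr add0r -scalerBl.
by rewrite opprD addrA subrr add0r dotNl dotNr opprK.
Qed.

Lemma coord_le_eucl_dist x y i : `|x ord0 i - y ord0 i| <= eucl_dist x y.
Proof.
rewrite -ler_sqr ?nnegrE ?eucl_dist_ge0// real_normK ?num_real//.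
rewrite /eucl_dist sqr_sqrtr ?sumr_ge0// => [|j _]; last exact: sqr_ge0.
by rewrite (bigD1 i)//= lerDl sumr_ge0// => j _; apply: sqr_ge0.
Qed.

Lemma eucl_stewart x y z t :
  eucl_dist z (x + t *: (y - x)) ^+ 2 =
  (1 - t) * eucl_dist z x ^+ 2 + t * eucl_dist z y ^+ 2
    - t * (1 - t) * eucl_dist x y ^+ 2.
Proof.
rewrite !eucl_dist_sqr !dotE (dotC y x) (dotC x z) (dotC y z).
ring.
Qed.

Lemma dot_polar x y z :
  2 * dot (x - z) (y - z) =
  eucl_dist x z ^+ 2 + eucl_dist y z ^+ 2 - eucl_dist x y ^+ 2.
Proof.
rewrite !eucl_dist_sqr !dotE (dotC y x) (dotC z x) (dotC z y).
ring.
Qed.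

End Euclid.

(** * CAT(0) spaces *)

Section CAT0theory.
Variables (R : realType) (Y : metricType R).
Implicit Types (x y z p : Y).

Lemma comparison_triangle (a b c : R) :
  0 <= a -> 0 <= b -> 0 <= c -> a <= b + c -> b <= c + a -> c <= a + b ->
  exists w0 w1 w2 : 'rV[R]_2,
    [/\ eucl_dist w0 w1 = a, eucl_dist w1 w2 = b & eucl_dist w2 w0 = c].
Proof.
move=> a0 b0 c0 abc bca cab.
pose vec (s t : R) : 'rV[R]_2 := \row_i (if i == ord0 then s else t).
have vecd s t s' t' :
    eucl_dist (vec s t) (vec s' t') = Num.sqrt ((s - s') ^+ 2 + (t - t') ^+ 2).
  by rewrite /eucl_dist big_ord_recl big_ord1 !mxE.
have [ae|an] := eqVneq a 0.
  have bc : b = c by lra.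
  exists (vec 0 0), (vec 0 0), (vec c 0); rewrite !vecd !subrr !subr0 !sub0r.
  by rewrite expr0n/= !addr0 sqrtr0 sqrrN !sqrtr_sqr ae bc ger0_norm.
have ap : 0 < a by rewrite lt_def an.
(* Abscissa of the third vertex by the law of cosines, the side of length [a] lying on the first
   axis. *)
pose s := (a ^+ 2 + c ^+ 2 - b ^+ 2) / (2 * a).
have sE : 2 * a * s = a ^+ 2 + c ^+ 2 - b ^+ 2 by rewrite /s; field.
have s2 : s ^+ 2 <= c ^+ 2.
  have h : `|2 * a * s| <= 2 * a * c by rewrite sE ler_norml; apply/andP; split; nra.
  rewrite normrM ger0_norm in h; last lra.
  rewrite ler_pM2l in h; last lra.
  by rewrite -[s ^+ 2]real_normK ?num_real// ler_sqr ?nnegrE.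
exists (vec 0 0), (vec a 0), (vec s (Num.sqrt (c ^+ 2 - s ^+ 2))).
rewrite !vecd !sub0r !subr0 !sqrrN expr0n/= addr0 !sqr_sqrtr ?subr_ge0//.
split; [by rewrite sqrtr_sqr ger0_norm| |].
- have -> : (a - s) ^+ 2 + (c ^+ 2 - s ^+ 2) = b ^+ 2.
    rewrite sqrrB mulr2n; lra.
  by rewrite sqrtr_sqr ger0_norm.
- by rewrite addrC subrK sqrtr_sqr ger0_norm.
Qed.

Lemma metric_comparison_triangle x y z :
  exists w0 w1 w2 : 'rV[R]_2, [/\ eucl_dist w0 w1 = mdist x y,
    eucl_dist w1 w2 = mdist y z & eucl_dist w2 w0 = mdist z x].
Proof.
have txy := metric_triangle x z y; have tyz := metric_triangle y x z.
have tzx := metric_triangle z y x.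
rewrite (metric_sym x z) (metric_sym z y) in txy.
rewrite (metric_sym y x) (metric_sym x z) in tyz.
rewrite (metric_sym z y) (metric_sym y x) in tzx.
apply: comparison_triangle; rewrite ?mdist_ge0//; lra.
Qed.

Lemma geodesic_rev x y c : geodesic x y c -> geodesic y x (fun s => c (mdist x y - s)).
Proof.
move=> [c0 c1 cd]; split; rewrite ?subr0// (metric_sym y x) ?subrr//.
move=> s t hs ht; rewrite cd; last 2 first.
- by apply/andP; split; lra.
- by apply/andP; split; lra.
by rewrite distrC; congr `|_|; ring.
Qed.

Lemma geodesic_dist0 x y c s : geodesic x y c -> 0 <= s <= mdist x y ->
  mdist x (c s) = s /\ mdist (c s) y = mdist x y - s.
Proof.
move=> [c0 c1 cd] hs; have ? := mdist_ge0 x y.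
have h0 : 0 <= (0 : R) <= mdist x y by apply/andP; split.
have h1 : 0 <= mdist x y <= mdist x y by apply/andP; split.
split.
- by rewrite -{1}c0 cd// sub0r normrN ger0_norm//; case/andP: hs.
- by rewrite -{1}c1 cd// distrC ger0_norm// subr_ge0; case/andP: hs.
Qed.

Hypothesis hY : CAT0_space Y.

(** By similarity the two comparison points are at distance exactly [t * mdist x y]. The sides in
    [CAT0_inequality] run cyclically, so the geodesic from [p] to [y] is reversed and its point has
    parameter [(1 - t) * mdist p y]. *)
Lemma CAT0_contract p x y cx cy t : geodesic p x cx -> geodesic p y cy ->
  0 <= t <= 1 -> mdist (cx (t * mdist p x)) (cy (t * mdist p y)) <= t * mdist x y.
Proof.
move=> gx gy /andP[t0 t1]; have [gs ineq] := hY.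
have [cxy gxy] := gs x y.
have [w0 [w1 [w2 [d0 d1 d2]]]] := metric_comparison_triangle p x y.
rewrite (metric_sym y p) in d2.
pose v (i : 'I_3) := nth p [:: p; x; y] i.
pose c (i : 'I_3) := nth cx [:: cx; cxy; fun s => cy (mdist p y - s)] i.
pose w (i : 'I_3) := nth w0 [:: w0; w1; w2] i.
have dpx := mdist_ge0 p x; have dpy := mdist_ge0 p y.
have := ineq v c w.
pose i0 : 'I_3 := @Ordinal 3 0 isT. pose i2 : 'I_3 := @Ordinal 3 2 isT.
have hc i : geodesic (v i) (v (ordS i)) (c i).
  by case: i => [[|[|[|//]]] lei] //; apply: geodesic_rev.
have hw i j : eucl_dist (w i) (w j) = mdist (v i) (v j).
  case: i => [[|[|[|//]]] lei]; case: j => [[|[|[|//]]] lej];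
  by rewrite /w /v/= ?eucl_distxx ?mdistxx// ?(d0,d1,d2)// (eucl_distC, metric_sym)
       ?(d0,d1,d2)// metric_sym// eucl_distC d2 metric_sym.
move=> /(_ hc hw i0 i2 (t * mdist p x) ((1 - t) * mdist p y)
  (w0 + t *: (w1 - w0)) (w0 + t *: (w2 - w0))) /=.
rewrite /v /c /w/= !(metric_sym y p).
have -> : mdist p y - (1 - t) * mdist p y = t * mdist p y by ring.
rewrite eucl_dist_scale d0 ger0_norm// (eucl_distC w2) (eucl_distC _ w0).
rewrite !eucl_dist_scale (eucl_distC w0 w2) d2 ger0_norm//.
have -> : w0 + t *: (w1 - w0) = w1 + (1 - t) *: (w0 - w1).
  by apply/rowP=> i; rewrite !mxE; ring.
rewrite (eucl_distC _ w1) eucl_dist_scale (eucl_distC w1) d0 ger0_norm ?subr_ge0//.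
have -> : eucl_dist (w0 + t *: (w2 - w0)) w2 = (1 - t) * mdist p y.
  have -> : w0 + t *: (w2 - w0) = w2 + (1 - t) *: (w0 - w2).
    by apply/rowP=> i; rewrite !mxE; ring.
  by rewrite eucl_distC eucl_dist_scale d2 ger0_norm ?subr_ge0.
have -> : eucl_dist (w1 + (1 - t) *: (w0 - w1)) (w0 + t *: (w2 - w0)) = t * mdist x y.
  rewrite -d1.
  have -> : w1 + (1 - t) *: (w0 - w1) = w0 + t *: (w1 - w0).
    by apply/rowP=> i; rewrite !mxE; ring.
  rewrite !eucl_distE -[t in RHS]ger0_norm// -sqrtr_sqr -sqrtrM ?sqr_ge0//.
  congr Num.sqrt; rewrite (_ : _ - _ = t *: (w1 - w2)); last first.
    by apply/rowP=> i; rewrite !mxE; ring.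
  by rewrite dotZl dotZr mulrA -expr2.
apply; try ring.
- by rewrite mulr_ge0//= ler_piMl.
- by rewrite mulr_ge0 ?subr_ge0//= ler_piMl// gerBl.
Qed.

(** [CAT0_inequality] speaks of points on given geodesics, while later points are known by their
    distances only. The concatenation of geodesics through [m] is 1-Lipschitz, and it cannot be
    shorter anywhere because its ends are at distance [mdist x y]. *)
Lemma geodesic_through x y m t : 0 <= t -> t <= 1 ->
  mdist x m = t * mdist x y -> mdist m y = (1 - t) * mdist x y ->
  exists2 c, geodesic x y c & c (mdist x m) = m.
Proof.
move=> t0 t1 xm my; have [gs _] := hY.
have [c1 g1] := gs x m; have [c2 g2] := gs m y.
have ? := mdist_ge0 x m; have ? := mdist_ge0 m y; have ? := mdist_ge0 x y.
have D : mdist x y = mdist x m + mdist m y by rewrite xm my; ring.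
pose c s := if s <= mdist x m then c1 s else c2 (s - mdist x m).
have [c10 c1m c1d] := g1; have [c20 c2y c2d] := g2.
have cm : c (mdist x m) = m by rewrite /c lexx.
have clt s t' : 0 <= s -> s <= t' -> t' <= mdist x y ->
    mdist (c s) (c t') <= t' - s.
  move=> s0 st tD; rewrite /c; case: ifPn => hs; case: ifPn => ht.
  - by rewrite c1d ?ler0_norm ?opprB ?subr_le0// ?s0 ?hs// ht andbT; lra.
  - rewrite -ltNge in ht.
    apply: le_trans (metric_triangle _ m _) _.
    have [|_ ->] := @geodesic_dist0 _ _ _ s g1; first by rewrite s0.
    have [|-> _] := @geodesic_dist0 _ _ _ (t' - mdist x m) g2.
      by apply/andP; split; lra.
    lra.
  - by lra.
  - rewrite -!ltNge in hs ht.
    rewrite c2d ?ler0_norm ?opprB; try lra; by apply/andP; split; lra.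
have c0 : c 0 = x by rewrite /c mdist_ge0.
have cD : c (mdist x y) = y.
  rewrite /c; case: ifPn => [h|]; last by rewrite D addrAC subrr add0r c2y.
  have my0 : mdist m y = 0 by lra.
  by have <- := mdist_positivity _ _ my0.
exists c => //; split=> //.
have cle (s u : R) : 0 <= s -> s <= u -> u <= mdist x y -> mdist (c s) (c u) = u - s.
  move=> s0 st tD; apply/eqP; rewrite eq_le clt//=.
  have a1 : mdist (c 0) (c s) <= s - 0 by apply: clt => //; lra.
  have a2 : mdist (c u) (c (mdist x y)) <= mdist x y - u by apply: clt => //; lra.
  rewrite c0 in a1; rewrite cD in a2.
  have b1 := metric_triangle x (c s) y; have b2 := metric_triangle (c s) (c u) y.
  lra.
move=> s t' /andP[s0 sD] /andP[t'0 tD]; have [st|/ltW ts] := leP s t'.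
  by rewrite cle// ler0_norm ?opprB// subr_le0.
by rewrite metric_sym cle// ger0_norm// subr_ge0.
Qed.

(** The Bruhat-Tits inequality at an arbitrary ratio: [m] is compared with the opposite vertex [z],
    seen as the end of the side from [y], and [eucl_stewart] computes the Euclidean distance. *)
Lemma CAT0_stewart x y m z t : 0 <= t <= 1 ->
  mdist x m = t * mdist x y -> mdist m y = (1 - t) * mdist x y ->
  mdist z m ^+ 2 <= (1 - t) * mdist z x ^+ 2 + t * mdist z y ^+ 2
                     - t * (1 - t) * mdist x y ^+ 2.
Proof.
move=> /andP[t0 t1] xm my; have [gs ineq] := hY.
have [c gc cm] := geodesic_through t0 t1 xm my.
have [cyz gyz] := gs y z; have [czx gzx] := gs z x.
have [w0 [w1 [w2 [d0 d1 d2]]]] := metric_comparison_triangle x y z.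
pose v (i : 'I_3) := nth x [:: x; y; z] i.
pose cc (i : 'I_3) := nth c [:: c; cyz; czx] i.
pose w (i : 'I_3) := nth w0 [:: w0; w1; w2] i.
have := ineq v cc w.
pose i0 : 'I_3 := @Ordinal 3 0 isT. pose i1 : 'I_3 := @Ordinal 3 1 isT.
have hc i : geodesic (v i) (v (ordS i)) (cc i).
  by case: i => [[|[|[|//]]] lei].
have hw i j : eucl_dist (w i) (w j) = mdist (v i) (v j).
  case: i => [[|[|[|//]]] lei]; case: j => [[|[|[|//]]] lej];
  by rewrite /w /v/= ?eucl_distxx ?mdistxx// ?(d0,d1,d2)//
       eucl_distC ?(d0,d1,d2) metric_sym.
have dxy := mdist_ge0 x y; have dyz := mdist_ge0 y z.
move=> /(_ hc hw i0 i1 (t * mdist x y) (mdist y z) (w0 + t *: (w1 - w0)) w2) /=.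
rewrite /v /cc /w/= -xm cm; have [_ -> _] := gyz.
rewrite eucl_dist_scale d0 ger0_norm// d1 eucl_distxx subrr xm.
have -> : eucl_dist (w0 + t *: (w1 - w0)) w1 = (1 - t) * mdist x y.
  have -> : w0 + t *: (w1 - w0) = w1 + (1 - t) *: (w0 - w1).
    by apply/rowP=> i; rewrite !mxE; ring.
  by rewrite eucl_distC eucl_dist_scale eucl_distC d0 ger0_norm ?subr_ge0.
have hm : mdist m z <= eucl_dist (w0 + t *: (w1 - w0)) w2 ->
  mdist z m ^+ 2 <= (1 - t) * mdist z x ^+ 2 + t * mdist z y ^+ 2
                     - t * (1 - t) * mdist x y ^+ 2.
  rewrite -d0 -d2 (metric_sym z y) -d1 (eucl_distC w1 w2) -eucl_stewart => h.
  by rewrite ler_sqr ?nnegrE ?mdist_ge0 ?eucl_dist_ge0// metric_sym (eucl_distC w2).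
move=> h; apply: hm; apply: h => //; try ring.
- by rewrite mulr_ge0//= ler_piMl.
- by rewrite dyz lexx.
Qed.

Lemma CAT0_midpoint x y : exists m, mdist x m = mdist x y / 2 /\ mdist m y = mdist x y / 2.
Proof.
have [gs _] := hY; have [c gc] := gs x y; have ? := mdist_ge0 x y.
exists (c (mdist x y / 2)).
have [|-> ->] := @geodesic_dist0 _ _ _ (mdist x y / 2) gc.
  by apply/andP; split; lra.
by split=> //; field.
Qed.

(** With [m'] as third vertex the right-hand side of [CAT0_stewart] vanishes. *)
Lemma CAT0_between_unique x y m m' t : 0 <= t <= 1 ->
  mdist x m = t * mdist x y -> mdist m y = (1 - t) * mdist x y ->
  mdist x m' = t * mdist x y -> mdist m' y = (1 - t) * mdist x y -> m = m'.
Proof.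
move=> t01 xm my xm' my'; apply: (@mdist_positivity _ Y); rewrite metric_sym.
apply/eqP; rewrite -sqrf_eq0 eq_le sqr_ge0 andbT.
apply: le_trans (CAT0_stewart m' t01 xm my) _.
by rewrite (metric_sym m' x) xm' my' le_eqVlt; apply/orP; left; apply/eqP; ring.
Qed.

End CAT0theory.

(** * Isometries between faces of cubes *)

Section Faces.
Variable R : realType.

Lemma isometry_onto_inv m n (A : set 'rV[R]_m) (B : set 'rV[R]_n) h :
  isometry_onto A B h ->
  exists2 g, isometry_onto B A g & forall x, A x -> g (h x) = x.
Proof.
move=> [hAB hd].
have /choice[g gP] (y : 'rV[R]_n) : exists x, B y -> A x /\ h x = y.
  have [By|nBy] := pselect (B y); last by exists 0.
  by move: By; rewrite -hAB => -[x Ax <-]; exists x.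
have hB x : A x -> B (h x) by rewrite -hAB => Ax; exists x.
have gh x : A x -> g (h x) = x.
  move=> Ax; have [Ag hg] := gP _ (hB _ Ax).
  by apply/eqP; rewrite -eucl_dist_eq0 -hd// hg eucl_distxx.
exists g => //; split.
  apply/seteqP; split => [_ [y /gP[? _] <-]//|x Ax].
  by exists (h x); [exact: hB|exact: gh].
move=> y y' By By'; have [Ay hy] := gP _ By; have [Ay' hy'] := gP _ By'.
by rewrite -hd// hy hy'.
Qed.

Section OneFace.
Variables (n : nat) (F : face n).

Definition nfree : nat := #|[pred i | F i == None]|.

Lemma face_fixed (x y : 'rV[R]_n) i :
  face_set F x -> face_set F y -> F i != None -> x ord0 i = y ord0 i.
Proof.
move=> [_ hx] [_ hy]; case E: (F i) => [b|//] _.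
by rewrite (hx _ _ E) (hy _ _ E).
Qed.

Lemma face_coord01 (x : 'rV[R]_n) i : face_set F x -> 0 <= x ord0 i <= 1.
Proof. by case. Qed.

Lemma face_dist_sqr (x y : 'rV[R]_n) : face_set F x -> face_set F y ->
  eucl_dist x y ^+ 2 = \sum_(i | F i == None) (x ord0 i - y ord0 i) ^+ 2.
Proof.
move=> hx hy; rewrite /eucl_dist sqr_sqrtr ?sumr_ge0// => [|j _]; last exact: sqr_ge0.
rewrite (bigID (fun i => F i == None))/= [X in _ + X]big1 ?addr0// => i Fi.
by rewrite (face_fixed hx hy Fi) subrr expr0n.
Qed.

Lemma sqr_diff_le1 (s t : R) : 0 <= s <= 1 -> 0 <= t <= 1 -> (s - t) ^+ 2 <= 1.
Proof. by move=> /andP[? ?] /andP[? ?]; nra. Qed.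

Lemma face_dist_le (x y : 'rV[R]_n) : face_set F x -> face_set F y ->
  eucl_dist x y ^+ 2 <= nfree%:R.
Proof.
move=> hx hy; rewrite face_dist_sqr// /nfree -sum1_card natr_sum.
by apply: ler_sum => i _; apply: sqr_diff_le1; apply: face_coord01.
Qed.

Definition is_corner (x : 'rV[R]_n) : Prop :=
  forall i, x ord0 i = 0 \/ x ord0 i = 1.

(** The squared distance is a sum of [nfree] terms, each at most 1, so the maximum forces every term
    to be 1. Corners are thereby recognised by the metric alone. *)
Lemma face_dist_max (x y : 'rV[R]_n) : face_set F x -> face_set F y ->
  eucl_dist x y ^+ 2 = nfree%:R -> is_corner x.
Proof.
move=> hx hy; rewrite face_dist_sqr// /nfree -sum1_card natr_sum => e i.
case E: (F i) => [b|].
  by rewrite (hx.2 _ _ E); case: b {E}; [right|left].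
have : (x ord0 i - y ord0 i) ^+ 2 = 1.
  apply/eqP; rewrite eq_le sqr_diff_le1 ?face_coord01//=.
  rewrite leNgt; apply/negP => lt1.
  have : \sum_(i | F i == None) (x ord0 i - y ord0 i) ^+ 2 <
         \sum_(i | F i == None) 1.
    rewrite (bigD1 i) ?E//= [ltRHS](bigD1 i) ?E//=.
    apply: ltr_leD => //; apply: ler_sum => j _.
    by apply: sqr_diff_le1; apply: face_coord01.
  by rewrite e ltxx.
have /andP[? ?] := face_coord01 i hx; have /andP[? ?] := face_coord01 i hy.
move=> h; have [x0|xn] := eqVneq (x ord0 i) 0; [by left|right].
have xp : 0 < x ord0 i by rewrite lt_def xn.
nra.
Qed.

Definition face_pt (s : 'I_n -> R) : 'rV[R]_n :=
  \row_i (if F i is Some b then b%:R else s i).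

Lemma face_ptP s : (forall i, 0 <= s i <= 1) -> face_set F (face_pt s).
Proof.
move=> s01; split=> [i|i b Fi]; rewrite mxE ?Fi//.
by case: (F i) => [[]|]//=; rewrite ?lexx ?ler01.
Qed.

Lemma face_pt_corner (b : 'I_n -> bool) :
  face_set F (face_pt (fun i => (b i)%:R)) /\
  exists2 y, face_set F y & eucl_dist (face_pt (fun i => (b i)%:R)) y ^+ 2 = nfree%:R.
Proof.
have h c : face_set F (face_pt (fun i => (c i : bool)%:R)).
  by apply: face_ptP => i; case: (c i); rewrite ?lexx ?ler01.
split => //; exists (face_pt (fun i => (~~ b i)%:R)) => //.
rewrite face_dist_sqr// /nfree -sum1_card natr_sum; apply: eq_bigr => i /eqP Fi.
by rewrite !mxE Fi; case: (b i); rewrite /= ?subr0 ?sub0r ?sqrrN ?expr1n.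
Qed.

Lemma corner_adjacent (x y : 'rV[R]_n) : face_set F x -> face_set F y ->
  is_corner x -> is_corner y -> eucl_dist x y ^+ 2 = 1 ->
  exists j, [/\ F j = None, x ord0 j != y ord0 j &
    forall k, k != j -> x ord0 k = y ord0 k].
Proof.
move=> hx hy cx cy; rewrite face_dist_sqr// => e.
have h i : (x ord0 i - y ord0 i) ^+ 2 = (x ord0 i != y ord0 i)%:R.
  have [->|] := eqVneq; first by rewrite subrr expr0n.
  case: (cx i) => ->; case: (cy i) => ->; rewrite ?eqxx// => _.
    by rewrite sub0r sqrrN expr1n.
  by rewrite subr0 expr1n.
have : #|[pred i | (F i == None) && (x ord0 i != y ord0 i)]| = 1%N.
  apply/eqP; rewrite -(eqr_nat R) -sum1_card natr_sum; apply/eqP.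
  apply: etrans e; rewrite [LHS]big_mkcondr/=; apply: eq_bigr => i _.
  by rewrite h; case: eqVneq.
move/mem_card1 => [j hj].
have /andP[/eqP Fj xyj] : j \in [pred i | (F i == None) && (x ord0 i != y ord0 i)].
  by rewrite hj inE.
exists j; split=> // k kj; apply/eqP/negPn/negP => xyk.
have [Fk|Fk] := eqVneq (F k) None; last first.
  by move: xyk; rewrite (face_fixed hx hy Fk) eqxx.
have : k \in [pred i | (F i == None) && (x ord0 i != y ord0 i)].
  by rewrite inE Fk eqxx.
by rewrite hj inE (negPf kj).
Qed.

End OneFace.

Section FaceIsometry.
Variables (m n : nat) (F : face m) (G : face n) (h : 'rV[R]_m -> 'rV[R]_n).

Definition coord_match (i : 'I_m) (j : 'I_n) : Prop :=
  (forall x, face_set F x -> h x ord0 j = x ord0 i) \/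
  (forall x, face_set F x -> h x ord0 j = 1 - x ord0 i).

Hypothesis hiso : @isometry_onto R m n (face_set F) (face_set G) h.

Lemma iso_face x : face_set F x -> face_set G (h x).
Proof. by case: hiso => <- _ hx; exists x. Qed.

Lemma iso_nfree_le : (nfree F <= nfree G)%N.
Proof.
have [h1 [y hy e]] := @face_pt_corner m F (fun=> false).
rewrite -(ler_nat R) -e -hiso.2//.
by apply: face_dist_le; apply: iso_face.
Qed.

End FaceIsometry.

Lemma iso_nfree m n (F : face m) (G : face n) h :
  @isometry_onto R m n (face_set F) (face_set G) h -> nfree F = nfree G.
Proof.
move=> hi; have [g gi _] := isometry_onto_inv hi.
by apply/eqP; rewrite eqn_leq (iso_nfree_le hi) (iso_nfree_le gi).
Qed.

(** A face isometry permutes and reflects the free coordinates. It preserves corners, the points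
    that realise the diameter, and edges, the pairs of corners at distance 1; [j] is the direction
    of the image of the edge from [o] to [p] along [i]. *)
Lemma iso_match m n (F : face m) (G : face n) h i :
  @isometry_onto R m n (face_set F) (face_set G) h -> F i = None ->
  exists2 j, G j = None & coord_match F h i j.
Proof.
move=> hi Fi.
have [a1 [a2 a2F ae]] := @face_pt_corner m F (fun=> false).
have [u1 [ p2 u2F pe] ] := @face_pt_corner m F (pred1 i).
move: a1 ae u1 pe; set o := face_pt _ _; set p := face_pt _ _ => a1 ae u1 pe.
have crn x y : face_set F x -> face_set F y ->
    eucl_dist x y ^+ 2 = (nfree F)%:R -> is_corner (h x).
  move=> hx hy e.
  apply: (@face_dist_max _ G _ (h y)); try exact: (iso_face hi).
  by rewrite hi.2// e (iso_nfree hi).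
have od : eucl_dist o p ^+ 2 = 1.
  rewrite (face_dist_sqr a1 u1) (bigD1 i) ?Fi//= !mxE Fi /= eqxx sub0r sqrrN expr1n.
  rewrite big1 ?addr0// => k /andP[/eqP Fk ki].
  by rewrite !mxE Fk /= (negPf ki) subrr expr0n.
have [|||||j [Gj ne eqk]] := @corner_adjacent _ G (h o) (h p).
- exact: (iso_face hi).
- exact: (iso_face hi).
- exact: crn ae.
- exact: crn pe.
- by rewrite hi.2.
exists j => //.
(* A coordinate is an affine function of the squared distances to the two ends of an edge in its
   direction: all other terms cancel. *)
have key x : face_set F x ->
    (h x ord0 j - h o ord0 j) ^+ 2 - (h x ord0 j - h p ord0 j) ^+ 2
    = 2 * x ord0 i - 1.
  move=> hx.
  have hE := @face_dist_sqr _ G _ _ (iso_face hi hx).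
  have := hE _ (iso_face hi u1); rewrite hi.2// (face_dist_sqr hx u1).
  have := hE _ (iso_face hi a1); rewrite hi.2// (face_dist_sqr hx a1).
  rewrite (bigD1 i) ?Fi//= [X in _ = X](bigD1 j) ?Gj//= => e1.
  rewrite (bigD1 i) ?Fi//= [X in _ = X](bigD1 j) ?Gj//= => e2.
  move: e1 e2.
  rewrite [X in _ + X = _ -> _](eq_bigr (fun k => (x ord0 k - p ord0 k) ^+ 2)); last first.
    by move=> k /andP[/eqP Fk ki]; rewrite !mxE Fk /= (negPf ki).
  rewrite [X in _ = _ + X -> _](eq_bigr (fun k => (h x ord0 k - h p ord0 k) ^+ 2)); last first.
    by move=> k /andP[_ kj]; rewrite eqk.
  rewrite !mxE Fi /= eqxx => e1 e2.
  have t1 : true%:R = 1 :> R by [].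
  by rewrite t1 in e1 e2; lra.
have [c1 c2] := (crn _ _ a1 a2F ae j, crn _ _ u1 u2F pe j).
case: c1 => c1; case: c2 => c2.
- by rewrite c1 c2 eqxx in ne.
- by left=> x /key; rewrite c1 c2; lra.
- by right=> x /key; rewrite c1 c2; lra.
- by rewrite c1 c2 eqxx in ne.
Qed.

Lemma iso_match_inv m n (F : face m) (G : face n) h j :
  @isometry_onto R m n (face_set F) (face_set G) h -> G j = None ->
  exists2 i, F i = None & coord_match F h i j.
Proof.
move=> hi Gj; have [g gi gh] := isometry_onto_inv hi.
have [i Fi [mt|mt]] := iso_match gi Gj; exists i => //.
  by left=> x hx; rewrite -mt ?gh//; exact: (iso_face hi).
right=> x hx; have := mt _ (iso_face hi hx); rewrite gh// => ->; ring.
Qed.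

Lemma iso_interior m n (F : face m) (G : face n) h x :
  @isometry_onto R m n (face_set F) (face_set G) h -> face_set F x ->
  face_interior F x -> face_interior G (h x).
Proof.
move=> hi Fx ix j; case E: (G j) => [b|]; first exact: (iso_face hi Fx).2.
have [i Fi] := iso_match_inv hi E; have := ix i; rewrite Fi => /andP[? ?].
by case=> ->//; apply/andP; split; lra.
Qed.

Lemma eucl_dist_axis n (x y : 'rV[R]_n) i :
  (forall k, k != i -> x ord0 k = y ord0 k) <->
  eucl_dist x y = `|x ord0 i - y ord0 i|.
Proof.
have sq : eucl_dist x y ^+ 2 = (x ord0 i - y ord0 i) ^+ 2 +
    \sum_(k | k != i) (x ord0 k - y ord0 k) ^+ 2.
  rewrite /eucl_dist sqr_sqrtr ?sumr_ge0// => [|j _]; last exact: sqr_ge0.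
  by rewrite (bigD1 i).
split=> [eqk|e].
  apply/eqP; rewrite -(@eqrXn2 _ 2) ?eucl_dist_ge0// sq real_normK ?num_real//.
  by rewrite big1 ?addr0// => k ki; rewrite eqk// subrr expr0n.
have /eqP : \sum_(k | k != i) (x ord0 k - y ord0 k) ^+ 2 = 0.
  by move: sq; rewrite e real_normK ?num_real//; lra.
rewrite psumr_eq0 => [/allP h k ki|k _]; last exact: sqr_ge0.
have /= := h k (mem_index_enum _).
by rewrite ki sqrf_eq0 subr_eq0 => /eqP.
Qed.

Lemma iso_axis m n (F : face m) (G : face n) h i x y :
  @isometry_onto R m n (face_set F) (face_set G) h -> face_set F x -> face_set F y ->
  x != y -> (forall k, k != i -> x ord0 k = y ord0 k) ->
  exists j, forall k, k != j -> h x ord0 k = h y ord0 k.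
Proof.
move=> hi hx hy xy eqk.
have Fi : F i = None.
  apply/eqP/negPn/negP => Fi; move/eqP: xy; apply; apply/rowP => k.
  have [->|/eqk//] := eqVneq k i; exact: face_fixed hx hy Fi.
have [j _ mt] := iso_match hi Fi; exists j.
apply/eucl_dist_axis; rewrite hi.2//; move/eucl_dist_axis: eqk => ->.
case: mt => mt; rewrite !mt//.
by rewrite opprB addrACA [1 + _]addrC addrA -distrC; congr `|_|; ring.
Qed.

Definition carrier n (x : 'rV[R]_n) : face n := fun i =>
  if x ord0 i == 0 then Some false else if x ord0 i == 1 then Some true else None.

Lemma carrier_interior n (x : 'rV[R]_n) : cube x -> face_interior (carrier x) x.
Proof.
move=> hx i; have /andP[? ?] := hx i; rewrite /carrier.
have [->//|x0] := eqVneq; have [->//|x1] := eqVneq.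
by rewrite !lt_def x0 eq_sym x1; apply/andP.
Qed.

Lemma carrier_face n (x : 'rV[R]_n) : cube x -> face_set (carrier x) x.
Proof.
move=> hx; split=> // i b; rewrite /carrier.
by have [->[<-]|_] := eqVneq; [|have [->[<-]|] := eqVneq].
Qed.

(** For [0 < e <= 1], a point of the cube closer than [e] to [x] has a carrier that contains [x]
    ([near_carrier]). Face isometries preserve the property ([iso_gapped]), so one [e] works in all
    cells through a point, even infinitely many. *)
Definition gapped n (e : R) (x : 'rV[R]_n) : Prop :=
  forall i, 0 < x ord0 i < 1 -> e <= x ord0 i <= 1 - e.

Lemma gapped_exists n (x : 'rV[R]_n) : exists e : R, 0 < e <= 1 /\ gapped e x.
Proof.
pose g i := if 0 < x ord0 i < 1 then Num.min (x ord0 i) (1 - x ord0 i) else 1.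
exists (\big[Num.min/1]_i g i); split.
  rewrite bigmin_le_id andbT; apply: lt_bigmin => // i _; rewrite /g.
  by case: ifP => // /andP[? ?]; rewrite lt_min subr_gt0; apply/andP.
move=> i fi; have : \big[Num.min/1]_i g i <= g i by exact: bigmin_le_cond.
by rewrite {2}/g fi le_min => /andP[? ?]; apply/andP; split; lra.
Qed.

Lemma iso_gapped m n (F : face m) (G : face n) h x e :
  @isometry_onto R m n (face_set F) (face_set G) h -> face_set F x ->
  gapped e x -> gapped e (h x).
Proof.
move=> hi Fx gx j; case E: (G j) => [b|].
  by rewrite ((iso_face hi Fx).2 _ _ E); case: b {E}; rewrite ltxx ?andbF.
have [i Fi [/(_ _ Fx)|/(_ _ Fx)] ->] := iso_match_inv hi E; first exact: gx.
by move=> /andP[? ?]; have /andP[? ?] : e <= x ord0 i <= 1 - e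
  by [apply: gx; apply/andP; split; lra]; apply/andP; split; lra.
Qed.

Lemma near_carrier n (e : R) (u v : 'rV[R]_n) : 0 < e <= 1 -> gapped e v ->
  cube u -> cube v -> eucl_dist u v < e -> face_set (carrier u) v.
Proof.
move=> /andP[e0 e1] gv hu hv uv; split=> // i b.
have := le_lt_trans (coord_le_eucl_dist u v i) uv.
rewrite /carrier; have /andP[? ?] := hv i.
have vc : v ord0 i = 0 \/ v ord0 i = 1 \/ e <= v ord0 i <= 1 - e.
  have [|v0] := eqVneq (v ord0 i) 0; first by left.
  have [|v1] := eqVneq (v ord0 i) 1; first by right; left.
  by right; right; apply: gv; rewrite !lt_def v0 eq_sym v1; apply/andP.
rewrite ltr_norml => /andP[? ?].
have [u0[<-]|_] := eqVneq; last (have [u1[<-]|//] := eqVneq).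
  by case: vc => [|[|/andP[? ?]]]//; lra.
by case: vc => [|[|/andP[? ?]]]//; lra.
Qed.

Lemma gapped_carrier_eq n (e : R) (u v : 'rV[R]_n) : 0 < e <= 1 ->
  gapped e u -> gapped e v ->
  cube u -> cube v -> eucl_dist u v < e -> carrier u = carrier v.
Proof.
move=> e01 gu gv hu hv uv.
have [_ hv'] := near_carrier e01 gv hu hv uv.
have [|_ hu'] := near_carrier e01 gu hv hu; first by rewrite eucl_distC.
apply/funext => i; case E: (carrier u i) => [b|].
  by have := hv' _ _ E; rewrite /carrier => ->; case: b {E}; rewrite eqxx ?oner_eq0.
case E': (carrier v i) => [b|//].
by move: E; have := hu' _ _ E'; rewrite /carrier => ->; case: b {E'}; rewrite eqxx ?oner_eq0.
Qed.

End Faces.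

(** * Cells of a CAT(0) cube complex are isometrically embedded *)

Section Complex.
Variables (R : realType) (Y : cube_complex R).
Implicit Types (a b : cell Y) (e l : R).
Local Notation char a := (@char_map R Y a).

(** A change of cell at a common point. A lift of [p] close to [u] lies in the carrier of [u], so
    [h] carries it along to the new cell. *)
Definition transfers a b (u : 'rV[R]_(cell_dim a)) (w : 'rV[R]_(cell_dim b)) h :=
  [/\ isometry_onto (face_set (carrier u)) (face_set (carrier w)) h, h u = w &
      forall z, face_set (carrier u) z -> char b (h z) = char a z].

(** [cc_glue] does not state that the gluing sends [u] to [w]; this is forced because both [h u] and
    [w] are in the open carrier of [w], where [char_map] is injective. *)
Lemma transfer_exists a b u w : cube u -> cube w -> char a u = char b w ->
  exists h, transfers u w h.
Proof.
move=> hu hw uw.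
have [h [hi hc]] := cc_glue (carrier_interior hu) (carrier_interior hw) uw.
exists h; split=> //; have hF := carrier_face hu.
apply: (@cc_inj _ Y b (carrier w)); rewrite ?inE.
- exact: iso_interior hi hF (carrier_interior hu).
- exact: carrier_interior.
- by rewrite hc.
Qed.

Lemma gapped_transfer a b u w e : cube u -> cube w ->
  char a u = char b w -> gapped e u -> gapped e w.
Proof.
move=> hu hw uw gu; have [h [hi <- _]] := transfer_exists hu hw uw.
exact: iso_gapped hi (carrier_face hu) gu.
Qed.

Lemma char_sep a (v w : 'rV[R]_(cell_dim a)) e : 0 < e <= 1 -> cube v -> cube w ->
  gapped e v -> gapped e w -> eucl_dist v w < e -> char a v = char a w -> v = w.
Proof.
move=> e01 hv hw gv gw vw; apply: (@cc_inj _ Y a (carrier v)); rewrite inE.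
  exact: carrier_interior.
by rewrite (gapped_carrier_eq e01 gv gw hv hw vw); exact: carrier_interior.
Qed.

Lemma cell_string_ge0 x y l : cell_string (@char_map R Y) x y l -> 0 <= l.
Proof. by elim=> // *; rewrite addr_ge0 ?eucl_dist_ge0. Qed.

Lemma mdist_le_string (x y : Y) l : cell_string (@char_map R Y) x y l -> mdist x y <= l.
Proof.
move=> s; rewrite -lee_fin (cc_dist x y); apply: ereal_inf_lbound.
by exists l.
Qed.

Lemma mdist_char_le a u w : cube u -> cube w ->
  mdist (char a u) (char a w) <= eucl_dist u w.
Proof.
move=> hu hw; rewrite -[leRHS]addr0; apply: mdist_le_string.
by apply: cell_string_cons => //; exact: cell_string_nil.
Qed.

Lemma cell_string_approx (x y : Y) e : 0 < e ->
  exists2 l, cell_string (@char_map R Y) x y l & l < mdist x y + e.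
Proof.
move=> e0; have h : ereal_inf [set l%:E | l in [set l | cell_string (@char_map R Y) x y l]] \is a fin_num.
  by rewrite -cc_dist.
have [_ [l hl <-]] := lb_ereal_inf_adherent e0 h.
by rewrite -cc_dist -EFinD lte_fin; exists l.
Qed.

(** * Following strings near a point *)

Section Local.
Variables (p : Y) (e : R).
Hypothesis e01 : 0 < e <= 1.
Hypothesis gp : forall a v, cube v -> char a v = p -> gapped e v.

Lemma transfer_base a b u v w h : cube u -> cube v -> cube w ->
  char a v = p -> eucl_dist u v < e ->
  transfers (a := a) (b := b) u w h ->
  [/\ face_set (carrier u) v, cube (h v), char b (h v) = p &
      eucl_dist w (h v) = eucl_dist u v].
Proof.
move=> hu hv hw cv uv [hi <- hc].
have hF := near_carrier e01 (gp hv cv) hu hv uv.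
split=> //; last by rewrite hi.2//; exact: carrier_face.
  by case: (iso_face hi hF).
by rewrite hc.
Qed.

Variables (T : Type) (D : T -> T -> R)
  (Phi : forall a, 'rV[R]_(cell_dim a) -> 'rV[R]_(cell_dim a) -> T).
Hypothesis D0 : forall x, D x x = 0.
Hypothesis Dtri : forall x y z, D x z <= D x y + D y z.
Hypothesis Phi_transfer : forall a b u v w h,
  cube u -> cube v -> cube w -> char a v = p -> eucl_dist u v < e ->
  transfers (a := a) (b := b) u w h -> Phi u v = Phi w (h v).
Hypothesis Phi_lip : forall a (u u' v : 'rV[R]_(cell_dim a)),
  cube u -> cube u' -> cube v -> char a v = p ->
  eucl_dist u v < e -> eucl_dist u' v < e ->
  D (Phi u v) (Phi u' v) <= eucl_dist u u'.

(** The string is followed step by step: each step changes the current cell by a transfer, which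
    also moves the lift of [p] and leaves [Phi] unchanged. Total length below [e] keeps the lift in
    the carrier of the current point. [Phi] is abstract because it will be the distance to [p], a
    constant, and the cone coordinates. *)
Lemma string_lip x y l : cell_string (@char_map R Y) x y l -> forall a u v,
  cube u -> cube v -> char a v = p -> char a u = x -> eucl_dist u v + l < e ->
  exists b w v', [/\ cube w /\ cube v', char b v' = p, char b w = y,
    eucl_dist w v' <= eucl_dist u v + l & D (Phi u v) (Phi w v') <= l].
Proof.
elim=> {x y l} [x a u v hu hv cv cu _|b w w' y l hw hw' s IH a u v hu hv cv cu lt].
  by exists a, u, v; rewrite D0 addr0.
have l0 := cell_string_ge0 s; have ww0 := eucl_dist_ge0 w w'.
have [h th] := transfer_exists hu hw cu.
have uv : eucl_dist u v < e by lra.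
have [hF chv phv ehv] := transfer_base hu hv hw cv uv th.
have tri := eucl_dist_triangle w w' (h v); rewrite (eucl_distC w' w) in tri.
have lt' : eucl_dist w' (h v) + l < e by lra.
have [b' [w2 [v2 [cc c1 c2 d1 d2]]]] := IH b w' (h v) hw' chv phv erefl lt'.
exists b', w2, v2; split=> //; first lra.
rewrite (Phi_transfer hu hv hw cv uv th).
apply: le_trans (Dtri _ (Phi w' (h v)) _) _; apply: lerD d2.
by apply: Phi_lip => //; lra.
Qed.

(** The radius [e / 4] makes the two points closer than [e / 2], so a nearly shortest string has
    length below [e / 2] and stays within [3 * e / 4] of the lift. Moved to the cell [b], that lift
    is closer than [e] to [v'], and [char_sep] identifies the two. *)
Lemma local_lip a b u v w v' : cube u -> cube v -> cube w -> cube v' ->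
  char a v = p -> char b v' = p -> eucl_dist u v < e / 4 -> eucl_dist w v' < e / 4 ->
  D (Phi u v) (Phi w v') <= mdist (char a u) (char b w).
Proof.
move=> hu hv hw hv' cv cv' uv wv'; have e0 : 0 < e by case/andP: e01.
have uw : mdist (char a u) (char b w) < e / 2.
  apply: le_lt_trans (metric_triangle _ p _) _.
  rewrite -{1}cv -cv' (metric_sym (char b v')).
  have h1 := mdist_char_le hu hv; have h2 := mdist_char_le hw hv'.
  by lra.
apply/ler_addgt0Pl => d d0; rewrite addrC.
pose d' := Num.min d (e / 2 - mdist (char a u) (char b w)).
have d'0 : 0 < d' by rewrite lt_min d0 subr_gt0.
have [l s ll] := cell_string_approx (char a u) (char b w) d'0.
have l1 : l < mdist (char a u) (char b w) + d.
  by apply: lt_le_trans ll _; rewrite lerD2l ge_min lexx.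
have l2 : l < e / 2.
  apply: lt_le_trans ll _; rewrite addrC -lerBrDr ge_min lexx orbT //.
have l3 : eucl_dist u v + l < e by lra.
have [b1 [w1 [v1 [[hw1 hv1] cv1 cw1 d1 d2]]]] := string_lip s hu hv cv erefl l3.
have [h th] := transfer_exists hw1 hw cw1.
have w1v1 : eucl_dist w1 v1 < e by lra.
have [hF chv phv ehv] := transfer_base hw1 hv1 hw cv1 w1v1 th.
have hv1E : h v1 = v'.
  apply: (@char_sep _ _ _ e) => //; try exact: gp; last by rewrite phv.
  have := eucl_dist_triangle w (h v1) v'; rewrite (eucl_distC (h v1) w) ehv; lra.
rewrite -hv1E -(Phi_transfer hw1 hv1 hw cv1 w1v1 th).
by lra.
Qed.

End Local.

(** This is [local_lip] with [Phi] the distance to the lift of the base point, which takes the value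
    0 at the base point itself. *)
Lemma local_dist a u v e : 0 < e <= 1 -> gapped e v -> cube u -> cube v ->
  eucl_dist u v < e / 4 -> mdist (char a u) (char a v) = eucl_dist u v.
Proof.
move=> e01 gv hu hv uv; have /andP[e0 _] := e01.
apply/eqP; rewrite eq_le mdist_char_le//=.
pose D (s t : R) := `|s - t|.
have gpv b w : cube w -> char b w = char a v -> gapped e w.
  by move=> hw cw; apply: gapped_transfer gv.
have := @local_lip (char a v) e e01 gpv R D (fun a u v => eucl_dist u v).
move=> /(_ _ _ _ _ a a u v v v hu hv hv hv erefl erefl uv).
rewrite eucl_distxx /D subr0 ger0_norm ?eucl_dist_ge0//; apply.
- by move=> x; rewrite subrr normr0.
- by move=> x y z; exact: ler_distD.
- move=> b b' u1 v1 w1 h hu1 hv1 hw1 cv1 uv1 th.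
  by have [_ _ _ ->] := transfer_base e01 gpv hu1 hv1 hw1 cv1 uv1 th.
- move=> b u1 u2 v1 _ _ _ _ _ _.
  have := eucl_dist_triangle u2 u1 v1; have := eucl_dist_triangle u1 u2 v1.
  rewrite (eucl_distC u2 u1) ler_norml => ? ?; apply/andP; split; lra.
- by lra.
Qed.

(** * From local to global isometry of cells *)

Hypothesis hY : CAT0_space Y.

(** Local geodesics are geodesics. With [x k.+1] the midpoint of [x k] and [x k.+2], [CAT0_stewart]
    bounds the squared distance from [x 0] to [x k.+2] below by [2 (k+1)^2 - k^2 + 2 = (k+2)^2]
    times [d ^+ 2]. *)
Lemma local_geodesic (x : nat -> Y) (d : R) N : 0 <= d ->
  (forall k, (k < N)%N -> mdist (x k) (x k.+1) = d) ->
  (forall k, (k.+1 < N)%N -> mdist (x k) (x k.+2) = 2 * d) ->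
  forall k, (k <= N)%N -> mdist (x 0%N) (x k) = k%:R * d.
Proof.
move=> d0 h1 h2.
suff H k : ((k <= N)%N -> mdist (x 0%N) (x k) = k%:R * d) /\
           ((k < N)%N -> mdist (x 0%N) (x k.+1) = k.+1%:R * d).
  by move=> k; case: (H k).
elim: k => [|k [IH1 IH2]]; split=> kN; rewrite ?mdistxx ?mul0r ?mul1r ?h1//.
  exact: IH2.
have kN1 : (k < N)%N by exact: ltnW.
have := IH1 (ltnW kN1); have := IH2 kN1 => e1 e0.
have t01 : 0 <= (2^-1 : R) <= 1 by apply/andP; split; lra.
have := CAT0_stewart hY (x 0%N) t01 (x := x k) (y := x k.+2) (m := x k.+1).
rewrite h2// h1// h1// e1 e0 => h.
apply/eqP; rewrite eq_le; apply/andP; split.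
  apply: le_trans (metric_triangle _ (x k.+1) _) _.
  by rewrite e1 h1// -[k.+2%:R]natr1 mulrDl mul1r.
have h3 : d = 2^-1 * (2 * d) by rewrite mulKf.
have h4 : d = (1 - 2^-1) * (2 * d) by field.
have {h h3 h4} := h h3 h4.
move=> h.
suff : (k.+2%:R * d) ^+ 2 <= mdist (x 0%N) (x k.+2) ^+ 2.
  by rewrite ler_sqr ?nnegrE ?mdist_ge0 ?mulr_ge0.
by move: h; rewrite -[k.+2%:R]natr1 -[k.+1%:R]natr1; lra.
Qed.

(** For [d <= s <= 1 - d] both ends have weight at least [d], so each coordinate is at least [2 * d]
    times its value at the midpoint, and likewise for its distance to 1. This gives a uniform gap
    away from the ends. *)
Lemma gapped_segment n (u w : 'rV[R]_n) (e d s : R) : cube u -> cube w -> 0 <= e ->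
  0 <= d <= 2^-1 -> gapped e (u + 2^-1 *: (w - u)) -> d <= s <= 1 - d ->
  gapped (2 * d * e) (u + s *: (w - u)).
Proof.
move=> hu hw e0 /andP[d0 d2] gm /andP[ds sd] i; rewrite !mxE.
have := gm i; rewrite !mxE; have /andP[u0 u1] := hu i; have /andP[w0 w1] := hw i.
move: (u ord0 i) (w ord0 i) u0 u1 w0 w1 => x y x0 x1 y0 y1 h.
have mE : x + 2^-1 * (y - x) = (x + y) / 2 by field.
have sE : x + s * (y - x) = (1 - s) * x + s * y by ring.
rewrite mE in h; rewrite sE => /andP[p0 p1].
have /h/andP[h1 h2] : 0 < (x + y) / 2 < 1.
  apply/andP; split.
    rewrite divr_gt0// lt_def addr_ge0// andbT; apply/eqP => xy.
    have xz : x = 0 by lra. 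
    have yz : y = 0 by lra.
    by move: p0; rewrite xz yz; lra.
  rewrite ltr_pdivrMr// mul1r lt_def; apply/andP; split; last lra.
  apply/eqP => xy.
  have xz : x = 1 by lra.
  have yz : y = 1 by lra.
  by move: p1; rewrite xz yz; lra.
have hs : d * (x + y) <= (1 - s) * x + s * y by nra.
have hs' : d * (2 - x - y) <= (1 - s) * (1 - x) + s * (1 - y) by nra.
have k1 : 2 * d * e <= d * (x + y) by nra.
have k2 : 2 * d * e <= d * (2 - x - y) by nra.
by apply/andP; split; lra.
Qed.

Lemma segment_cube n (u w : 'rV[R]_n) s : cube u -> cube w -> 0 <= s <= 1 ->
  cube (u + s *: (w - u)).
Proof.
move=> hu hw /andP[s0 s1] i; rewrite !mxE.
by have /andP[? ?] := hu i; have /andP[? ?] := hw i; apply/andP; split; nra.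
Qed.

(** The gap can shrink to 0 at the ends of the segment, so a proportion [d] is cut off at each end.
    The rest is subdivided into a local geodesic of length [(1 - 2 * d) * L]; the triangle
    inequality at the two ends costs another [2 * d * L], and [d] tends to 0. *)
Lemma cell_isometry a u w : cube u -> cube w ->
  mdist (char a u) (char a w) = eucl_dist u w.
Proof.
move=> hu hw; apply/eqP; rewrite eq_le mdist_char_le//=.
pose L := eucl_dist u w; rewrite -/L; have L0 : 0 <= L by exact: eucl_dist_ge0.
have [e [/andP[e0 e1] ge]] := gapped_exists (u + 2^-1 *: (w - u)).
suff H d : 0 < d < 2^-1 -> (1 - 4 * d) * L <= mdist (char a u) (char a w).
  apply/ler_addgt0Pl => t t0.
  pose d := Num.min (4^-1) (t / (4 * (L + 1))).
  have d0 : 0 < d by rewrite lt_min divr_gt0 ?mulr_gt0//; lra.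
  have d1 : d <= 4^-1 by rewrite ge_min lexx.
  have d2 : d * (4 * (L + 1)) <= t.
    by rewrite -ler_pdivlMr ?ge_min ?lexx ?orbT// mulr_gt0//; lra.
  have /H : 0 < d < 2^-1 by apply/andP; split=> //; lra.
  nra.
move=> /andP[d0 d1]; pose e' := 2 * d * e.
have e'0 : 0 < e' by rewrite /e' !mulr_gt0.
have e'1 : e' <= 1 by rewrite /e'; nra.
(* The 8 makes two consecutive steps together shorter than [e' / 4], the radius of [local_dist]. *)
have [N hN] : exists N : nat, 8 * L / e' < N.+1%:R.
  exists (Num.truncn (8 * L / e')).
  by have /andP[] := truncn_itv (divr_ge0 (mulr_ge0 (ler0n _ 8) L0) (ltW e'0)).
pose s k := d + k%:R * ((1 - 2 * d) / N.+1%:R).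
pose z k := u + s k *: (w - u).
have N0 : 0 < N.+1%:R :> R by rewrite ltr0n.
pose st := (1 - 2 * d) / N.+1%:R.
have st0 : 0 <= st by rewrite divr_ge0//; lra.
have stN : N.+1%:R * st = 1 - 2 * d by rewrite /st mulrCA divff ?mulr1// gt_eqF.
have sb k : (k <= N.+1)%N -> d <= s k <= 1 - d.
  move=> kN; have : k%:R * st <= N.+1%:R * st by rewrite ler_wpM2r// ler_nat.
  have : 0 <= k%:R * st by rewrite mulr_ge0.
  rewrite stN /s -/st => ? ?; apply/andP; split; lra.
have cz k : (k <= N.+1)%N -> cube (z k).
  by move=> /sb/andP[? ?]; apply: segment_cube => //; apply/andP; split; lra.
have gz k : (k <= N.+1)%N -> gapped e' (z k).
  by move=> /sb; apply: gapped_segment => //; [exact: ltW|apply/andP; split; lra].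
have stL : 2 * (st * L) < e' / 4.
  have : 8 * L * st < e'.
    rewrite ltr_pdivrMr// in hN; rewrite /st mulrA ltr_pdivrMr//.
    have : 8 * L * (1 - 2 * d) <= 8 * L by rewrite ler_piMr ?mulr_ge0//; lra.
    by rewrite [_ * N.+1%:R]mulrC; lra.
  lra.
have dz j k : (k <= j)%N -> eucl_dist (z j) (z k) = (j - k)%:R * (st * L).
  move=> kj; rewrite eucl_dist_seg /s -/st.
  have -> : d + j%:R * st - (d + k%:R * st) = (j - k)%:R * st.
    by rewrite natrB//; ring.
  have js0 : 0 <= (j - k)%:R * st by exact: mulr_ge0 (ler0n _ _) st0.
  by rewrite (ger0_norm js0) -mulrA.
have := @local_geodesic (fun k => char a (z k)) (st * L) N.+1 _ _ _ N.+1 (leqnn _).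
rewrite (mulrA N.+1%:R st L) stN => h.
have {h} hz : mdist (char a (z 0%N)) (char a (z N.+1)) = (1 - 2 * d) * L.
  apply: h => [|k kN|k kN]; first exact: mulr_ge0.
  - rewrite metric_sym (@local_dist a _ _ e') ?dz ?subSnn ?mul1r ?e'0//.
    + exact/gz/ltnW.
    + exact: cz.
    + exact/cz/ltnW.
    + by have : 0 <= st * L by [exact: mulr_ge0]; lra.
  - have k2 : (k <= k.+2)%N by rewrite -addn2 leq_addr.
    have e2 : (k.+2 - k)%N = 2%N by rewrite -addn2 addKn.
    rewrite metric_sym (@local_dist a _ _ e') ?dz ?e2 ?e'0//.
    + exact/gz/ltnW/ltnW.
    + exact: cz.
    + exact/cz/ltnW/ltnW.
have t1 := metric_triangle (char a (z 0%N)) (char a u) (char a (z N.+1)).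
have t2 := metric_triangle (char a u) (char a w) (char a (z N.+1)).
have u0 : mdist (char a (z 0%N)) (char a u) <= d * L.
  rewrite metric_sym; apply: le_trans (mdist_char_le hu (cz _ _)) _ => //.
  by rewrite eucl_dist_scale /s mul0r addr0 ger0_norm// ltW.
have w0 : mdist (char a w) (char a (z N.+1)) <= d * L.
  apply: le_trans (mdist_char_le hw (cz _ _)) _ => //.
  have -> : w = u + 1 *: (w - u) by rewrite scale1r addrC subrK.
  rewrite {1}/z eucl_dist_seg /s -/st stN.
  by rewrite (_ : 1 - _ = d); [rewrite ger0_norm// ltW|ring].
lra.
Qed.

End Complex.

(** * Coordinates at a point *)

(** Used to compare sums over directions with sums over coordinates, where only the positive terms
    have a partner and no partner is shared. *)
Lemma sum_relation_le (R : realDomainType) (I J : finType) (P : I -> J -> bool)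
    (c : I -> R) (g : J -> R) :
  (forall j, 0 <= g j) ->
  (forall i, 0 < c i -> exists2 j, P i j & c i <= g j) ->
  (forall j i i', P i j -> P i' j -> i = i') ->
  \sum_i c i <= \sum_j g j.
Proof.
move=> g0 cg uniqP.
have h1 i : c i <= \sum_(j | P i j) g j.
  have [c0|c0] := leP (c i) 0; first exact: le_trans c0 (sumr_ge0 _ _).
  have [j Pij cij] := cg i c0; apply: le_trans cij _.
  by rewrite (bigD1 j)//= lerDl sumr_ge0.
apply: le_trans (ler_sum _ (fun i _ => h1 i)) _.
rewrite (exchange_big_dep predT)//=; apply: ler_sum => j _.
have [i Pij|nP] := pickP (fun i => P i j); last by rewrite big_pred0.
rewrite (big_pred1 i)// => i'; apply/idP/eqP => [/uniqP/(_ Pij)//|->//].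
Qed.

Section Cone.
Variables (R : realType) (Y : cube_complex R).
Local Notation char a := (@char_map R Y a).
Implicit Types (a b : cell Y).
Hypothesis hY : CAT0_space Y.

Lemma char_inj a (u w : 'rV[R]_(cell_dim a)) : cube u -> cube w ->
  char a u = char a w -> u = w.
Proof.
move=> hu hw uw; apply/eqP; rewrite -eucl_dist_eq0 -(cell_isometry hY)// uw.
by rewrite mdistxx.
Qed.

(** By [cell_isometry] both segments are geodesics with the same ends, and geodesics are unique. *)
Lemma char_segment a b (x y : 'rV[R]_(cell_dim a)) (x' y' : 'rV[R]_(cell_dim b)) s :
  cube x -> cube y -> cube x' -> cube y' -> 0 <= s <= 1 ->
  char a x = char b x' -> char a y = char b y' ->
  char a (x + s *: (y - x)) = char b (x' + s *: (y' - x')).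
Proof.
move=> hx hy hx' hy' s01 xx yy; have /andP[s0 s1] := s01.
have d c (u w : 'rV[R]_(cell_dim c)) : cube u -> cube w ->
    mdist (char c u) (char c (u + s *: (w - u))) = s * mdist (char c u) (char c w) /\
    mdist (char c (u + s *: (w - u))) (char c w) = (1 - s) * mdist (char c u) (char c w).
  move=> hu hw; have hs := segment_cube hu hw s01.
  rewrite !(cell_isometry hY)// eucl_dist_scale ger0_norm//; split=> //.
  have {2}-> : w = u + 1 *: (w - u) by rewrite scale1r addrC subrK.
  by rewrite eucl_dist_seg distrC ger0_norm ?subr_ge0.
have [d1 d2] := d _ _ _ hx hy; have [d3 d4] := d _ _ _ hx' hy'.
by apply: (CAT0_between_unique hY s01 d1 d2); rewrite xx yy.
Qed.

(** Two cells agree at [v + sum of g k *: (x k - v)] once they agree at [v] and at the [x k]: it is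
    the midpoint of [v + 2 * g k *: (x k - v)] and of the sum over the remaining points with doubled
    weights. One doubling per point explains [2 ^+ size C]. *)
Lemma char_common_face a b (I : eqType) (C : seq I)
    (x : I -> 'rV[R]_(cell_dim a)) (x' : I -> 'rV[R]_(cell_dim b)) v v' g :
  cube v -> cube v' -> char a v = char b v' ->
  (forall k, k \in C -> [/\ cube (x k), cube (x' k) & char a (x k) = char b (x' k)]) ->
  (forall k, k \in C -> 0 <= g k /\ g k * 2 ^+ size C <= 1) ->
  [/\ cube (v + \sum_(k <- C) g k *: (x k - v)),
      cube (v' + \sum_(k <- C) g k *: (x' k - v')) &
      char a (v + \sum_(k <- C) g k *: (x k - v)) =
      char b (v' + \sum_(k <- C) g k *: (x' k - v'))].
Proof.
move=> hv hv' vv; elim: C g => [|k C IH] g hx hg; first by rewrite !big_nil !addr0.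
have [||h1 h2 h3] := IH (fun k => 2 * g k).
- by move=> l lC; apply: hx; rewrite inE lC orbT.
- move=> l lC; have [|g0 g1] := hg l; first by rewrite inE lC orbT.
  by split; [rewrite mulr_ge0|rewrite mulrAC -exprS mulrC].
have [|g0 g1] := hg k; first by rewrite inE eqxx.
have [|k1 k2 k3] := hx k; first by rewrite inE eqxx.
have g01 : 0 <= 2 * g k <= 1.
  rewrite mulr_ge0//=; apply: le_trans g1; rewrite [leRHS]mulrC ler_wpM2r//=.
  by rewrite exprS ler_peMr// exprn_ege1// ler1n.
have s1 := segment_cube hv k1 g01; have s2 := segment_cube hv' k2 g01.
have s3 := char_segment hv k1 hv' k2 g01 vv k3.
have half : 0 <= (2^-1 : R) <= 1 by apply/andP; split; lra.
have E c (w : 'rV[R]_(cell_dim c)) (z : I -> 'rV[R]_(cell_dim c)) :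
    w + \sum_(l <- k :: C) g l *: (z l - w) =
    (w + (2 * g k) *: (z k - w)) +
     2^-1 *: ((w + \sum_(l <- C) (2 * g l) *: (z l - w)) - (w + (2 * g k) *: (z k - w))).
  have -> : \sum_(l <- C) (2 * g l) *: (z l - w) = 2 *: \sum_(l <- C) g l *: (z l - w).
    by rewrite scaler_sumr; apply: eq_bigr => l _; rewrite scalerA.
  rewrite big_cons; move: (\sum_(l <- C) _) => S.
  by apply/rowP => i; rewrite !mxE; field.
rewrite !E; split.
- exact: segment_cube.
- exact: segment_cube.
- exact: char_segment.
Qed.

Variables (p : Y) (e : R).
Hypothesis e01 : 0 < e <= 1.
Hypothesis gp : forall a v, cube v -> char a v = p -> gapped e v.

Let eta := e / 2.
Let eta0 : 0 < eta. Proof. by rewrite divr_gt0//; case/andP: e01. Qed.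
Let eta1 : eta < e. Proof. by case/andP: e01 => ? ?; rewrite /eta; lra. Qed.

(* A direction at p is recorded by the point at distance e / 2 from p on the
   corresponding edge germ. *)
Definition direction (q : Y) : Prop :=
  exists a v x, [/\ cube v, cube x, char a v = p, char a x = q &
    eucl_dist x v = e / 2 /\ exists i, forall k, k != i -> x ord0 k = v ord0 k].

Lemma direction_axis q a v x : direction q -> cube v -> cube x ->
  char a v = p -> char a x = q ->
  eucl_dist x v = e / 2 /\ exists i, forall k, k != i -> x ord0 k = v ord0 k.
Proof.
move=> [b [v0 [x0 [hv0 hx0 cv0 cx0 [d0 [i ax]]]]]] hv hx cv cx.
split; first by rewrite -(cell_isometry hY)// cx cv -cx0 -cv0 (cell_isometry hY).
have xx : char b x0 = char a x by rewrite cx0.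
have [h th] := transfer_exists hx0 hx xx.
have d0e : eucl_dist x0 v0 < e by rewrite d0.
have [hF chv phv _] := transfer_base e01 gp hx0 hv0 hx cv0 d0e th.
have [hi hx0E hc] := th.
have hvE : h v0 = v by apply: char_inj => //; rewrite phv.
rewrite -hvE -hx0E; apply: iso_axis hi (carrier_face hx0) hF _ ax.
by rewrite -eucl_dist_eq0 d0 gt_eqF.
Qed.

(* The component of the vector from v to u along the direction q; [xget]
   returns v, and hence the component is 0, when the cell does not contain q. *)
Definition component (q : Y) a (u v : 'rV[R]_(cell_dim a)) : R :=
  Num.max 0 (dot (u - v) (xget v [set x | cube x /\ char a x = q] - v)) / eta.

Lemma component_in q a u v x : cube x -> char a x = q ->
  component q u v = Num.max 0 (dot (u - v) (x - v)) / eta.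
Proof.
move=> hx cx; rewrite /component; case: xgetP => [y _ [hy cy]|/(_ x)[]//].
by rewrite (char_inj hy hx)// cx.
Qed.

Lemma component_ge0 q a u v : 0 <= @component q a u v.
Proof. by rewrite divr_ge0 ?le_max ?lexx// ltW. Qed.

Lemma component_gt0 q a u v : 0 < @component q a u v ->
  exists x, [/\ cube x, char a x = q, 0 < dot (u - v) (x - v) &
                component q u v = dot (u - v) (x - v) / eta].
Proof.
rewrite /component; case: xgetP => [x _ [hx cx]|_ ].
  rewrite pmulr_lgt0 ?invr_gt0// lt_max ltxx /= => h; exists x; split=> //.
  by rewrite max_r// ltW.
by rewrite subrr dotC dot0l maxxx mul0r ltxx.
Qed.

Lemma dot_axis n (y x v : 'rV[R]_n) i :
  (forall k, k != i -> x ord0 k = v ord0 k) ->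
  dot y (x - v) = y ord0 i * (x ord0 i - v ord0 i).
Proof.
move=> ax; rewrite /dot (bigD1 i)//= big1 ?addr0 ?mxE// => k ki.
by rewrite !mxE ax// subrr mulr0.
Qed.

(** A positive component means that [u] and [v] differ along the axis of [q], so this axis is free
    in the carrier of [u]. The carrier then contains the point [x] of direction [q], and the
    isometry preserves the inner product by polarisation. *)
Lemma component_transfer_gt0 q a b u v w h : direction q ->
  cube u -> cube v -> cube w -> char a v = p -> eucl_dist u v < e ->
  @transfers R Y a b u w h -> 0 < component q u v ->
  component q w (h v) = component q u v.
Proof.
move=> dq hu hv hw cv uv th /component_gt0[x [hx cx xp ->]].
have [hF chv phv _] := transfer_base e01 gp hu hv hw cv uv th.
have [hi <- hc] := th.
have [_ [i ax]] := direction_axis dq hv hx cv cx.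
have uFi := carrier_face hu.
have xF : face_set (carrier u) x.
  split=> // k bk Fk; rewrite -(hF.2 _ _ Fk); apply: (ax); apply/eqP => ki.
  move: xp; rewrite (dot_axis _ ax) !mxE -ki.
  by rewrite (uFi.2 _ _ Fk) (hF.2 _ _ Fk) subrr mul0r ltxx.
have hhx : cube (h x) by case: (iso_face hi xF).
rewrite (component_in _ _ hhx); last by rewrite hc.
have -> : dot (h u - h v) (h x - h v) = dot (u - v) (x - v).
  have two0 : 2 != 0 :> R by [].
  apply: (mulfI two0); rewrite !dot_polar; case: hi => _ hd; rewrite !hd//.
by rewrite max_r// ltW.
Qed.

(** Only a positive component passes through a change of cell directly; a zero component is treated
    by transferring back from [w] to [u]. *)
Lemma component_transfer q a b u v w h : direction q ->
  cube u -> cube v -> cube w -> char a v = p -> eucl_dist u v < e ->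
  @transfers R Y a b u w h -> component q u v = component q w (h v).
Proof.
move=> dq hu hv hw cv uv th.
have [/component_transfer_gt0 H|le0] := ltP 0 (component q u v).
  exact/esym/(H b w h).
have [hF chv phv ehv] := transfer_base e01 gp hu hv hw cv uv th.
have [hp|le0'] := ltP 0 (component q w (h v)); last first.
  by apply/eqP; rewrite eq_le (le_trans le0) ?(le_trans le0') ?component_ge0.
have wu : char b w = char a u by case: th => _ <- ->//; exact: carrier_face.
have [h' th'] := transfer_exists hw hu wu.
have ehv' : eucl_dist w (h v) < e by rewrite ehv.
have [_ chv' phv' _] := transfer_base e01 gp hw chv hu phv ehv' th'.
rewrite -(component_transfer_gt0 dq hw chv hu phv ehv' th' hp).
by congr component; apply: char_inj => //; rewrite phv'.
Qed.

Variables (N : nat) (q : 'I_N -> Y).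
Hypothesis q_inj : injective q.
Hypothesis q_dir : forall k, direction (q k).

Definition components a (u v : 'rV[R]_(cell_dim a)) : 'rV[R]_N :=
  \row_k component (q k) u v.

(** Inside a cell the components are positive and negative parts of the coordinates of [u - v], and
    splitting a real number into these parts does not increase distances. Each signed axis [(i, b)]
    carries at most one direction because [q] is injective. *)
Lemma components_lip_cell a (u u' v : 'rV[R]_(cell_dim a)) : cube v -> char a v = p ->
  eucl_dist (components u v) (components u' v) <= eucl_dist u u'.
Proof.
move=> hv cv; rewrite /eucl_dist ler_wsqrtr//.
have pair_sum : \sum_(ib : 'I_(cell_dim a) * bool)
    (let t := (-1) ^+ ib.2 * (u ord0 ib.1 - v ord0 ib.1) in
     let t' := (-1) ^+ ib.2 * (u' ord0 ib.1 - v ord0 ib.1) in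
     (Num.max 0 t - Num.max 0 t') ^+ 2)
     <= \sum_i (u ord0 i - u' ord0 i) ^+ 2.
  rewrite -(pair_bigA _ (fun i (b : bool) =>
    (Num.max 0 ((-1) ^+ b * (u ord0 i - v ord0 i)) -
     Num.max 0 ((-1) ^+ b * (u' ord0 i - v ord0 i))) ^+ 2))/=.
  apply: ler_sum => i _; rewrite big_bool/= !expr0 !expr1 !mul1r !mulN1r.
  have -> : u ord0 i - u' ord0 i = (u ord0 i - v ord0 i) - (u' ord0 i - v ord0 i) by ring.
  move: (u ord0 i - _) (u' ord0 i - _) => t t'.
  rewrite /Num.max/Order.max !oppr_gt0.
  by case: (ltrgtP 0 t) => ?; case: (ltrgtP 0 t') => ?; nra.
apply: le_trans _ pair_sum.
apply: (@sum_relation_le _ _ _ (fun k (ib : 'I_(cell_dim a) * bool) =>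
  let x := v + ((-1) ^+ ib.2 * eta) *: delta_mx ord0 ib.1 in
  `[< cube x /\ char a x = q k >])).
- by move=> ib; apply: sqr_ge0.
- move=> k; rewrite !mxE => ck.
  have [[x [hx cx]]|nx] := pselect (exists x, cube x /\ char a x = q k); last first.
    have c0 w : component (q k) w v = 0.
      apply/eqP; rewrite eq_le component_ge0 andbT leNgt; apply/negP.
      by move=> /component_gt0[x [hx cx _ _]]; apply: nx; exists x.
    by rewrite !c0 subrr expr0n ltxx in ck.
  have [dx [i ax]] := direction_axis (q_dir k) hv hx cv cx.
  have dxi : `|x ord0 i - v ord0 i| = eta by rewrite -(eucl_dist_axis _ _ _).1.
  pose b := x ord0 i - v ord0 i < 0.
  have xi : x ord0 i - v ord0 i = (-1) ^+ b * eta.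
    rewrite -dxi /b; case: ltP => h; first by rewrite ltr0_norm//; ring.
    by rewrite ger0_norm//; ring.
  exists (i, b) => /=.
    apply/asboolP; rewrite -xi.
    suff -> : v + (x ord0 i - v ord0 i) *: delta_mx ord0 i = x by [].
    apply/rowP => k'; rewrite !mxE eqxx/=; have [->|k'i] := eqVneq k' i.
      by rewrite mulr1 addrC subrK.
    by rewrite mulr0 addr0 ax.
  have cE w : component (q k) w v = Num.max 0 ((-1) ^+ b * (w ord0 i - v ord0 i)).
    rewrite (component_in _ _ hx)// (dot_axis _ ax) xi !mxE.
    rewrite mulrCA mulrA -[X in Num.max X _](mul0r eta) -maxr_pMl ?ltW//.
    by rewrite mulfK// gt_eqF.
  by rewrite !cE.
- move=> [i b] k k' /asboolP[_ h] /asboolP[_ h']; apply: q_inj.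
  by rewrite -h -h'.
Qed.

Lemma components_lip a b u v w v' : cube u -> cube v -> cube w -> cube v' ->
  char a v = p -> char b v' = p -> eucl_dist u v < e / 4 -> eucl_dist w v' < e / 4 ->
  eucl_dist (components u v) (components w v') <= mdist (char a u) (char b w).
Proof.
apply: (local_lip e01 gp (D := @eucl_dist R N) (Phi := components)).
- exact: eucl_distxx.
- by move=> x y z; exact: eucl_dist_triangle.
- move=> *; apply/rowP => k; rewrite !mxE.
  by apply: component_transfer => //.
- by move=> *; apply: components_lip_cell.
Qed.

Definition spoke a (u v : 'rV[R]_(cell_dim a)) i : 'rV[R]_(cell_dim a) :=
  v + (Num.sg (u ord0 i - v ord0 i) * (e / 2)) *: delta_mx ord0 i.

(** The gap at [v] leaves room for a step of [e / 2] in any free coordinate; at a coordinate 0 or 1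
    the point [u] can only lie on the inner side. *)
Lemma spoke_direction a u v i : cube u -> cube v -> char a v = p ->
  u ord0 i != v ord0 i ->
  cube (spoke u v i) /\ direction (char a (spoke u v i)).
Proof.
move=> hu hv cv ui.
have ax k : k != i -> spoke u v i ord0 k = v ord0 k.
  by move=> ki; rewrite !mxE eqxx (negPf ki)/= mulr0 addr0.
have sg1 : Num.sg (u ord0 i - v ord0 i) = 1 \/ Num.sg (u ord0 i - v ord0 i) = -1.
  by case: sgrP => [/eqP|_|_]; [rewrite subr_eq0 (negPf ui)|left|right].
have hs : cube (spoke u v i).
  move=> k; have [->|/ax->] := eqVneq k i; last exact: hv.
  rewrite !mxE !eqxx/= mulr1; have /andP[v0 v1] := hv i; have /andP[u0 u1] := hu i.
  have /andP[? ?] := e01; have g := gp hv cv (i := i).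
  case: sgrP => [/eqP|lt|lt]; first by rewrite subr_eq0 (negPf ui).
    have [vz|vn] := eqVneq (v ord0 i) 0; first by rewrite vz; apply/andP; split; lra.
    have /g/andP[? ?] : 0 < v ord0 i < 1 by rewrite lt_def vn v0/=; lra.
    by apply/andP; split; lra.
  have [vz|vn] := eqVneq (v ord0 i) 1; first by rewrite vz; apply/andP; split; lra.
  have /g/andP[? ?] : 0 < v ord0 i < 1 by apply/andP; split; [lra|rewrite lt_def eq_sym vn].
  by apply/andP; split; lra.
split=> //; exists a, v, (spoke u v i); split=> //; split; last by exists i.
rewrite ((eucl_dist_axis _ _ _).1 ax) !mxE !eqxx/= mulr1 addrAC subrr add0r.
by rewrite normrM normr_sg subr_eq0 ui mul1r ger0_norm// ltW.
Qed.

(** Each nonzero coordinate of [u - v] is, up to sign, the component along its own spoke, and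
    different coordinates have different spokes. *)
Lemma components_norm_ge a u v : cube u -> cube v -> char a v = p ->
  (forall i, u ord0 i != v ord0 i -> exists k, q k = char a (spoke u v i)) ->
  dot (u - v) (u - v) <= dot (components u v) (components u v).
Proof.
move=> hu hv cv hq; rewrite /dot.
apply: (@sum_relation_le _ _ _ (fun i k =>
  (u ord0 i != v ord0 i) && (q k == char a (spoke u v i)))).
- by move=> k; rewrite -expr2 sqr_ge0.
- move=> i; rewrite !mxE => ck.
  have ui : u ord0 i != v ord0 i.
    by apply: contraTneq ck => ->; rewrite subrr mul0r ltxx.
  have [k hk] := hq i ui; exists k; first by rewrite ui hk eqxx.
  have [hs _] := spoke_direction hu hv cv ui.
  have ax k' : k' != i -> spoke u v i ord0 k' = v ord0 k'.
    by move=> ki; rewrite !mxE eqxx (negPf ki)/= mulr0 addr0.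
  rewrite !mxE (component_in _ _ hs)// (dot_axis _ ax) !mxE !eqxx/= mulr1.
  rewrite [_ + _ - v ord0 i]addrAC subrr add0r.
  move: (u ord0 i - v ord0 i) => t.
  have -> : t * (Num.sg t * (e / 2)) = `|t| * eta by rewrite mulrCA mulrA -normrEsg.
  have te : 0 <= `|t| * eta by exact: mulr_ge0 (normr_ge0 _) (ltW eta0).
  rewrite (max_r te) mulfK ?gt_eqF//.
  by rewrite -!expr2 real_normK ?num_real.
- move=> k i i' /andP[ui /eqP h] /andP[ui' /eqP h'].
  have [hs _] := spoke_direction hu hv cv ui.
  have [hs' _] := spoke_direction hu hv cv ui'.
  have ss : spoke u v i = spoke u v i' by apply: char_inj => //; rewrite -h.
  apply/eqP/negPn/negP => ii; have := congr1 (fun x : 'rV_ _ => x ord0 i) ss.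
  rewrite !mxE !eqxx/= (negPf ii) mulr1 mulr0 addr0 => /eqP.
  rewrite -subr_eq0 addrAC subrr add0r mulf_eq0 sgr_eq0 subr_eq0 (negPf ui)/=.
  by rewrite gt_eqF.
Qed.

End Cone.

(** * Distances between two cells through a common face *)

Section ConeUpper.
Variables (R : realType) (Y : cube_complex R).
Local Notation char a := (@char_map R Y a).
Implicit Types (a b : cell Y).
Hypothesis hY : CAT0_space Y.
Variables (p : Y) (e : R).
Hypothesis e01 : 0 < e <= 1.
Hypothesis gp : forall a v, cube v -> char a v = p -> gapped e v.
Variables (N : nat) (q : 'I_N -> Y).
Hypothesis q_inj : injective q.
Hypothesis q_dir : forall k, direction p e (q k).

Let eta := e / 2.
Let eta0 : 0 < eta. Proof. by rewrite divr_gt0//; case/andP: e01. Qed.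

Lemma dot_suml n (I : finType) (P : pred I) (f : I -> 'rV[R]_n) y :
  dot (\sum_(i | P i) f i) y = \sum_(i | P i) dot (f i) y.
Proof.
by elim/big_rec2: _ => [|i x z _ <-]; [rewrite dot0l|rewrite dotDl].
Qed.

Section Foot.
Variables (a : cell Y) (u v : 'rV[R]_(cell_dim a)).
Hypothesis hv : cube v.
Hypothesis cv : char a v = p.

Local Notation alpha k := (component e (q k) u v).

Lemma component_points : exists x : 'I_N -> 'rV[R]_(cell_dim a),
  forall k, 0 < alpha k -> [/\ cube (x k), char a (x k) = q k &
    dot (u - v) (x k - v) = alpha k * eta].
Proof.
suff /choice[x hx] : forall k, exists x, 0 < alpha k -> [/\ cube x, char a x = q k &
    dot (u - v) (x - v) = alpha k * eta] by exists x.
move=> k; have [/(component_gt0 e01)[x [hx cx _ ax]]|_] := ltP 0 (alpha k).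
  by exists x => _; split=> //; rewrite ax divfK// gt_eqF.
by exists v.
Qed.

Variable x : 'I_N -> 'rV[R]_(cell_dim a).
Hypothesis hx : forall k, 0 < alpha k -> [/\ cube (x k), char a (x k) = q k &
    dot (u - v) (x k - v) = alpha k * eta].

(** Two directions on the same axis, both with positive component, point to the side of [u], so they
    coincide; distinct ones are on distinct axes. *)
Lemma component_ortho k l : 0 < alpha k -> 0 < alpha l ->
  dot (x k - v) (x l - v) = (k == l)%:R * eta ^+ 2.
Proof.
move=> ak al; have [hxk ck dk] := hx ak; have [hxl cl dl] := hx al.
have [nk [i axk]] := direction_axis hY e01 gp (q_dir k) hv hxk cv ck.
have [nl [j axl]] := direction_axis hY e01 gp (q_dir l) hv hxl cv cl.
have [<-|kl] := eqVneq k l; first by rewrite -eucl_dist_sqr nk mul1r.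
rewrite mul0r (dot_axis _ axl) !mxE; have [ij|ij] := eqVneq j i; last first.
  by rewrite axk// subrr mul0r.
exfalso; move/eqP: kl; apply; apply: q_inj; rewrite -ck -cl; congr char_map.
rewrite -ij in axk; move: nk nl.
rewrite ((eucl_dist_axis _ _ _).1 axk) ((eucl_dist_axis _ _ _).1 axl).
rewrite (dot_axis _ axk) in dk; rewrite (dot_axis _ axl) in dl.
have pk := mulr_gt0 ak eta0; have pl := mulr_gt0 al eta0.
rewrite -dk in pk; rewrite -dl in pl => nk nl.
suff e1 : x k ord0 j = x l ord0 j.
  apply/rowP => m; have [->|mj] := eqVneq m j; first exact: e1.
  by rewrite axk// axl.
move: nk; rewrite -nl; move: pk pl; set z := (u - v) ord0 j.
by case: ger0P => ?; case: ger0P => ?; nra.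
Qed.

(** Pythagoras with respect to the face spanned at [v] by the directions in [C]: [A] is the part of
    [u - v] along this face, and the normal part has squared length
    [dot (u - v) (u - v) - dot A A]. *)
Lemma foot_dist (C : pred 'I_N) (g : 'rV[R]_N) (s : R)
    (A := \row_k (if C k then alpha k else 0)) :
  (forall k, C k -> 0 < alpha k) -> (forall k, ~~ C k -> g ord0 k = 0) ->
  eucl_dist (v + s *: (u - v)) (v + \sum_(k | C k) (g ord0 k / eta) *: (x k - v)) ^+ 2
  = s ^+ 2 * (dot (u - v) (u - v) - dot A A) + dot (s *: A - g) (s *: A - g).
Proof.
move=> Cpos gC; rewrite eucl_dist_sqr opprD addrACA subrr add0r.
set W := \sum_(k | C k) _.
have uW : dot W (u - v) = dot g A.
  rewrite dot_suml /dot [RHS](bigID C)/= [X in _ = _ + X]big1 ?addr0; last first.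
    by move=> k /gC ->; rewrite mul0r.
  apply: eq_bigr => k Ck; rewrite mxE Ck.
  have [_ _] := hx (Cpos k Ck); rewrite -/(dot _ _) dotZl dotC => ->.
  by rewrite [alpha k * _]mulrC mulrA divfK// gt_eqF.
have WW : dot W W = dot g g.
  rewrite {1}/W dot_suml [in RHS]/dot [RHS](bigID C)/=.
  rewrite [X in _ = _ + X]big1 ?addr0; last by move=> k /gC ->; rewrite mul0r.
  apply: eq_bigr => k Ck; rewrite dotZl dotC dot_suml (bigD1 k)//=.
  rewrite big1 ?addr0.
    rewrite dotZl component_ortho ?Cpos// eqxx mul1r; field.
    by rewrite gt_eqF.
  move=> l /andP[Cl lk]; rewrite dotZl component_ortho ?Cpos// (negPf lk).
  by rewrite mul0r mulr0.
move: A uW => A uW; clearbody W; move: (u - v) uW => xi uW.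
rewrite !dotE (dotC _ W) uW WW (dotC A g); ring.
Qed.

End Foot.

Lemma sqrt_CS (x1 x2 y1 y2 : R) : 0 <= x1 -> 0 <= x2 -> 0 <= y1 -> 0 <= y2 ->
  Num.sqrt x1 * Num.sqrt y1 + Num.sqrt x2 * Num.sqrt y2 <=
  Num.sqrt (x1 + x2) * Num.sqrt (y1 + y2).
Proof.
move=> hx1 hx2 hy1 hy2; rewrite -ler_sqr ?nnegrE ?addr_ge0 ?mulr_ge0 ?sqrtr_ge0//.
rewrite sqrrD !exprMn !sqr_sqrtr ?addr_ge0//.
have := sqr_ge0 (Num.sqrt x1 * Num.sqrt y2 - Num.sqrt x2 * Num.sqrt y1).
rewrite sqrrB !exprMn !sqr_sqrtr// mulr2n; lra.
Qed.

(* Unfold the two cells along their common face, making the directions normal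
   to it opposite: the segment of the unfolded picture crosses the face at the
   point X = X' below, and S is its length. *)
Lemma cone_upper a b (u v : 'rV[R]_(cell_dim a)) (w v' : 'rV[R]_(cell_dim b)) :
  cube u -> cube v -> cube w -> cube v' -> char a v = p -> char b v' = p ->
  exists2 t0, 0 < t0 <= 1 & forall s t, 0 <= s <= t0 -> 0 <= t <= t0 ->
    mdist (char a (v + s *: (u - v))) (char b (v' + t *: (w - v'))) ^+ 2 <=
    s ^+ 2 * eucl_dist u v ^+ 2 + t ^+ 2 * eucl_dist w v' ^+ 2 -
    2 * s * t * (2 * dot (components e q u v) (components e q w v') -
                 eucl_dist u v * eucl_dist w v').
Proof.
move=> hu hv hw hv' cv cv'.
pose al k := component e (q k) u v; pose be k := component e (q k) w v'.
have al0 k : 0 <= al k by exact: component_ge0.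
have be0 k : 0 <= be k by exact: component_ge0.
have [x hx] := component_points u v; have [x' hx'] := component_points w v'.
pose C k := (0 < al k) && (0 < be k).
have Cal k : C k -> 0 < al k by case/andP.
have Cbe k : C k -> 0 < be k by case/andP.
pose A := \row_k (if C k then al k else 0); pose B := \row_k (if C k then be k else 0).
have AB : dot (components e q u v) (components e q w v') = dot A B.
  apply: eq_bigr => k _; rewrite !mxE -/(al k) -/(be k) /C.
  by have := al0 k; have := be0 k; rewrite !le_eqVlt;
    do 2![case/predU1P => [<-|->]]; rewrite ?ltxx ?andbF/= ?mulr0 ?mul0r.
pose M := \sum_k (al k + be k).
have M0 : 0 <= M by rewrite sumr_ge0// => k _; rewrite addr_ge0.
have Mk k : al k + be k <= M.
  by rewrite /M (bigD1 k)//= lerDl sumr_ge0// => l _; rewrite addr_ge0.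
have N2 : 1 <= 2 ^+ N :> R by rewrite exprn_ege1// ler1n.
have den0 : 0 < 2 ^+ N * (eta + M).
  by rewrite mulr_gt0 ?exprn_gt0// ltr_wpDr.
(* [M] bounds every [al k] and [be k], so this bound on [s] and [t] makes the weights of the
   crossing point small enough for [char_common_face]. *)
exists (eta / (2 ^+ N * (eta + M))).
  rewrite divr_gt0//= ler_pdivrMr// mul1r.
  have := eta0; nra.
move=> s t /andP[s0 s1] /andP[t0 t1].
have pxi := eucl_dist_sqr u v; have pze := eucl_dist_sqr w v'.
have fa g := @foot_dist a u v hv cv x hx C g s Cal.
have fb g := @foot_dist b w v' hv' cv' x' hx' C g t Cbe.
rewrite -/A in fa; rewrite -/B in fb.
have AC k : ~~ C k -> A ord0 k = 0 by rewrite mxE => /negPf ->.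
have BC k : ~~ C k -> B ord0 k = 0 by rewrite mxE => /negPf ->.
have ra : 0 <= dot (u - v) (u - v) - dot A A.
  have := @foot_dist a u v hv cv x hx C A 1 Cal AC.
  by rewrite -/A expr1n mul1r !scale1r subrr dot0l addr0 => <-; exact: sqr_ge0.
have rb : 0 <= dot (w - v') (w - v') - dot B B.
  have := @foot_dist b w v' hv' cv' x' hx' C B 1 Cbe BC.
  by rewrite -/B expr1n mul1r !scale1r subrr dot0l addr0 => <-; exact: sqr_ge0.
pose rA := s * Num.sqrt (dot (u - v) (u - v) - dot A A).
pose rB := t * Num.sqrt (dot (w - v') (w - v') - dot B B).
have rAE : rA = s * Num.sqrt (dot (u - v) (u - v) - dot A A) by [].
have rBE : rB = t * Num.sqrt (dot (w - v') (w - v') - dot B B) by [].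
have rA0 : 0 <= rA by rewrite mulr_ge0 ?sqrtr_ge0.
have rB0 : 0 <= rB by rewrite mulr_ge0 ?sqrtr_ge0.
(* Proportion of the unfolded segment before the crossing. If [rA + rB = 0] the quotient is 0, and
   the two equations below still hold. *)
clearbody rA rB; pose th := rA / (rA + rB).
have [thA thB] : rA = th * (rA + rB) /\ rB = (1 - th) * (rA + rB).
  have [z|nz] := eqVneq (rA + rB) 0.
    by rewrite z !mulr0; split; lra.
  have h : rA = th * (rA + rB) by rewrite /th divfK.
  by split=> //; rewrite mulrBl -h mul1r addrAC subrr add0r.
have th0 : 0 <= th by rewrite divr_ge0 ?addr_ge0.
have th1 : th <= 1.
  have [z|nz] := eqVneq (rA + rB) 0; first by rewrite /th z invr0 mulr0.
  have zp : 0 < rA + rB by rewrite lt_def nz addr_ge0.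
  by rewrite ler_pdivrMr// mul1r lerDl.
clearbody th; have thc0 : 0 <= 1 - th by rewrite subr_ge0.
have thc1 : 1 - th <= 1 by rewrite gerBl.
pose g : 'rV[R]_N := s *: A - th *: (s *: A - t *: B).
have gE k : g ord0 k = if C k then (1 - th) * (s * al k) + th * (t * be k) else 0.
  by rewrite !mxE; case: (C k); ring.
have gC k : ~~ C k -> g ord0 k = 0 by rewrite gE => /negPf ->.
pose S := Num.sqrt ((rA + rB) ^+ 2 + dot (s *: A - t *: B) (s *: A - t *: B)).
have S2 : S ^+ 2 = (rA + rB) ^+ 2 + dot (s *: A - t *: B) (s *: A - t *: B).
  by rewrite sqr_sqrtr// addr_ge0 ?sqr_ge0 ?dot_ge0.
have S0 : 0 <= S by exact: sqrtr_ge0.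
pose X := v + \sum_(k | C k) (g ord0 k / eta) *: (x k - v).
pose X' := v' + \sum_(k | C k) (g ord0 k / eta) *: (x' k - v').
have sq (r d : R) : 0 <= r -> 0 <= d -> r ^+ 2 = d ^+ 2 -> r = d.
  by move=> r0 d0 /eqP; rewrite eqrXn2// => /eqP.
have dX : eucl_dist (v + s *: (u - v)) X = th * S.
  apply: sq; [exact: eucl_dist_ge0|exact: mulr_ge0 th0 S0|].
  have := fa g gC; rewrite -/X => ->; rewrite exprMn S2.
  have -> : s *: A - g = th *: (s *: A - t *: B) by rewrite /g opprB addrC subrK.
  have -> : s ^+ 2 * (dot (u - v) (u - v) - dot A A) = rA ^+ 2.
    by rewrite rAE exprMn sqr_sqrtr.
  have -> : rA ^+ 2 = th ^+ 2 * (rA + rB) ^+ 2 by rewrite {1}thA exprMn.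
  rewrite dotZl dotZr; ring.
have dX' : eucl_dist (v' + t *: (w - v')) X' = (1 - th) * S.
  apply: sq; [exact: eucl_dist_ge0|exact: mulr_ge0 thc0 S0|].
  have := fb g gC; rewrite -/X' => ->; rewrite exprMn S2.
  have -> : t ^+ 2 * (dot (w - v') (w - v') - dot B B) = rB ^+ 2.
    by rewrite rBE exprMn sqr_sqrtr.
  have -> : t *: B - g = - (1 - th) *: (s *: A - t *: B).
    by rewrite /g; apply/rowP => k; rewrite !mxE; ring.
  have -> : rB ^+ 2 = (1 - th) ^+ 2 * (rA + rB) ^+ 2 by rewrite {1}thB exprMn.
  rewrite dotZl dotZr; ring.
have [|||cX cX' XX'] := @char_common_face R Y hY a b _ (enum C) x x' v v'
  (fun k => g ord0 k / eta) hv hv'.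
- by rewrite cv cv'.
- move=> k; rewrite mem_enum => Ck.
  have [? ck _] := hx k (Cal _ Ck); have [? ck' _] := hx' k (Cbe _ Ck).
  by split=> //; rewrite ck ck'.
- move=> k; rewrite mem_enum => kC; have Ck : C k := kC; rewrite gE Ck; split.
    apply: divr_ge0 (ltW eta0); apply: addr_ge0.
      by apply: mulr_ge0 => //; exact: mulr_ge0.
    by apply: mulr_ge0 => //; exact: mulr_ge0.
  rewrite mulrAC ler_pdivrMr// mul1r.
  have C2 : 2 ^+ size (enum C) <= 2 ^+ N :> R.
    by rewrite ler_eXn2l ?ltr1n// -cardE -[leqRHS]card_ord max_card.
  have t1e : eta / (2 ^+ N * (eta + M)) * (2 ^+ N * (eta + M)) = eta.
    by rewrite divfK// gt_eqF.
  have t10 : 0 <= eta / (2 ^+ N * (eta + M)) by exact: divr_ge0 (ltW eta0) (ltW den0).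
  move: (eta / _) s1 t1 t1e t10 => t1' s1 t1 t1e t10.
  have gt : (1 - th) * (s * al k) + th * (t * be k) <= t1' * M.
    have h1 : s * al k <= t1' * al k by rewrite ler_wpM2r.
    have h2 : t * be k <= t1' * be k by rewrite ler_wpM2r.
    have h3 : (1 - th) * (s * al k) <= s * al k.
      exact: ler_piMl (mulr_ge0 s0 (al0 k)) thc1.
    have h4 : th * (t * be k) <= t * be k by exact: ler_piMl (mulr_ge0 t0 (be0 k)) th1.
    have h5 : t1' * (al k + be k) <= t1' * M.
      by rewrite ler_wpM2l.
    apply: le_trans (lerD h3 h4) _; apply: le_trans (lerD h1 h2) _.
    by rewrite -mulrDr.
  apply: le_trans (ler_wpM2r (exprn_ge0 _ _) gt) _ => //.
  apply: le_trans (ler_wpM2l _ C2) _; first exact: mulr_ge0.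
  rewrite -[leRHS]t1e -mulrA ler_wpM2l// [leLHS]mulrC ler_wpM2l//.
  by rewrite lerDr ltW.
rewrite !big_enum/= -/X -/X' in cX cX' XX'.
have s01 : 0 <= s <= 1.
  rewrite s0; apply: le_trans s1 _; rewrite ler_pdivrMr// mul1r.
  have := eta0; nra.
have t01 : 0 <= t <= 1.
  rewrite t0; apply: le_trans t1 _; rewrite ler_pdivrMr// mul1r.
  have := eta0; nra.
have dS : mdist (char a (v + s *: (u - v))) (char b (v' + t *: (w - v'))) <= S.
  apply: le_trans (metric_triangle _ (char a X) _) _.
  have -> : S = th * S + (1 - th) * S by ring.
  apply: lerD; first by rewrite -dX; apply: mdist_char_le => //; exact: segment_cube.
  rewrite XX' metric_sym -dX'; apply: mdist_char_le => //; exact: segment_cube.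
apply: le_trans (_ : S ^+ 2 <= _); first by rewrite ler_sqr ?nnegrE ?mdist_ge0.
rewrite S2 AB pxi pze.
(* The opposite normals contribute [2 * rA * rB] to [S ^+ 2]. Cauchy-Schwarz bounds it by
   [2 * s * t] times [eucl_dist u v * eucl_dist w v' - dot A B], which produces the second [dot A B]
   of the conclusion. *)
have cs : dot A B + Num.sqrt (dot (u - v) (u - v) - dot A A) *
    Num.sqrt (dot (w - v') (w - v') - dot B B) <= eucl_dist u v * eucl_dist w v'.
  rewrite !eucl_distE.
  have -> : dot (u - v) (u - v) = dot A A + (dot (u - v) (u - v) - dot A A) by ring.
  have -> : dot (w - v') (w - v') = dot B B + (dot (w - v') (w - v') - dot B B) by ring.
  rewrite [X in _ + Num.sqrt X * _](_ : _ = dot (u - v) (u - v) - dot A A); last by ring.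
  rewrite [X in _ + _ * Num.sqrt X](_ : _ = dot (w - v') (w - v') - dot B B); last by ring.
  apply: le_trans (sqrt_CS (dot_ge0 _) ra (dot_ge0 _) rb).
  rewrite lerD2r; apply: le_trans (ler_norm _) _.
  by rewrite -sqrtrM ?dot_ge0// -sqrtr_sqr ler_wsqrtr// dot_CS.
have st0 : 0 <= s * t by rewrite mulr_ge0.
have := ler_wpM2l st0 cs.
have rAB : rA ^+ 2 = s ^+ 2 * (dot (u - v) (u - v) - dot A A) by rewrite rAE exprMn sqr_sqrtr.
have rBB : rB ^+ 2 = t ^+ 2 * (dot (w - v') (w - v') - dot B B) by rewrite rBE exprMn sqr_sqrtr.
have -> : (rA + rB) ^+ 2 = rA ^+ 2 + rB ^+ 2 + 2 * (rA * rB) by ring.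
rewrite rAB rBB rAE rBE !dotE (dotC B A); lra.
Qed.

End ConeUpper.

(** * Barycenters *)

Section Barycenter.
Variables (R : realType) (Y : metricType R).
Hypothesis hY : CAT0_space Y.
Hypothesis hYc : complete_space Y.
Variables (V : finType) (m : V -> R) (f : V -> Y).
Hypothesis m0 : forall v, 0 <= m v.
Hypothesis M0 : 0 < \sum_v m v.

Definition moment (y : Y) : R := \sum_v m v * mdist y (f v) ^+ 2.

Lemma moment_ge0 y : 0 <= moment y.
Proof. by apply: sumr_ge0 => v _; rewrite mulr_ge0// sqr_ge0. Qed.

Lemma moment_midpoint y z : exists x, moment x <=
  (moment y + moment z) / 2 - (\sum_v m v) * mdist y z ^+ 2 / 4.
Proof.
have [x [d1 d2]] := CAT0_midpoint hY y z; exists x.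
have half : 0 <= (2^-1 : R) <= 1 by apply/andP; split; lra.
have -> : (moment y + moment z) / 2 - (\sum_v m v) * mdist y z ^+ 2 / 4 =
  \sum_v m v * ((mdist y (f v) ^+ 2 + mdist z (f v) ^+ 2) / 2 - mdist y z ^+ 2 / 4).
  rewrite /moment -big_split/= !mulr_suml -sumrB; apply: eq_bigr => v _; ring.
apply: ler_sum => v _; apply: ler_wpM2l => //.
rewrite !(metric_sym _ (f v)).
apply: le_trans (CAT0_stewart hY (f v) half (x := y) (y := z) _ _) _.
- by rewrite d1 mulrC.
- by rewrite d2; field.
- by rewrite le_eqVlt; apply/orP; left; apply/eqP; field.
Qed.

Lemma barycenter_exists : exists p, forall y, moment p <= moment y.
Proof.
have [v0 _|V0] := pickP (@predT V); last by move: M0; rewrite big_pred0// ltxx.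
pose I := inf (range moment).
have rI : has_inf (range moment).
  split; first by exists (moment (f v0)), (f v0).
  by exists 0 => _ [y _ <-]; exact: moment_ge0.
have Ile y : I <= moment y by apply: ge_inf; [case: rI|exists y].
have I0 : 0 <= I.
  by apply: lb_le_inf; [case: rI|move=> _ [y _ <-]; exact: moment_ge0].
pose S (d : R) := [set y | moment y < I + d].
have Sn d : 0 < d -> exists y, S d y.
  by move=> d0; have [_ [y _ <-] h] := inf_adherent d0 rI; exists y.
have MM := M0; set M := \sum_v m v in MM.
(* If two near-minimisers were farther apart, their midpoint would have moment below the infimum.
   The sublevel sets therefore generate a Cauchy filter. *)
have SS d y z : S d y -> S d z -> M * mdist y z ^+ 2 <= 4 * d.
  rewrite /S/= => hy hz; have [x hx] := moment_midpoint y z.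
  have := Ile x; rewrite -/M in hx; lra.
pose F := filter_from [set d : R | 0 < d] S.
have FF : ProperFilter F.
  apply: filter_from_proper; last by move=> d /Sn.
  apply: filter_from_filter; first by exists 1 => /=.
  move=> d d' /= d0 d'0; exists (Num.min d d'); first by rewrite /= lt_min d0.
  by move=> y; rewrite /S/= -ltrBlDl lt_min => /andP[? ?]; split; lra.
have Fc : cauchy F.
  apply: cauchy_exP => e e0.
  have d0 : 0 < M * e ^+ 2 / 8 by rewrite divr_gt0// mulr_gt0// exprn_gt0.
  have [x hx] := Sn _ d0; exists x, (M * e ^+ 2 / 8) => //= y hy.
  rewrite ballEmdist/= -ltr_sqr ?nnegrE ?mdist_ge0 ?(ltW e0)//.
  rewrite -(ltr_pM2l MM); apply: le_lt_trans (SS _ _ _ hx hy) _.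
  have : 0 < M * e ^+ 2 by rewrite mulr_gt0// exprn_gt0.
  lra.
have [p Fp] := hYc FF Fc; exists p => y; apply: le_trans (Ile y).
suff H d : 0 < d <= 1 -> moment p <= I + d * (I + 2 + 2 * M).
  apply/ler_addgt0Pl => t t0; rewrite addrC.
  pose k := I + 2 + 2 * M.
  have k0 : 0 < k by rewrite /k; lra.
  have /H h : 0 < Num.min 1 (t / k) <= 1 by rewrite lt_min ltr01 divr_gt0// ge_min lexx.
  apply: le_trans h _; rewrite lerD2l -/k -ler_pdivlMr//.
  by rewrite ge_min lexx orbT.
move=> /andP[d0 d1].
have [d' /= d'0 hd'] := Fp _ (nbhsx_ballx p d d0); rewrite ballEmdist in hd'.
have d''0 : 0 < Num.min d d' by rewrite lt_min d0.
have [z] := Sn _ d''0; rewrite /S/= -ltrBlDl lt_min => /andP[zd zd'].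
have /hd'/= pz : S d' z by rewrite /S/=; lra.
(* From [x <= t + d] and [2 * t <= t ^+ 2 + 1] one gets [x ^+ 2 <= (1 + d) * t ^+ 2 + d + d ^+ 2];
   this replaces continuity of the moment. *)
have : moment p <= (1 + d) * moment z + (d + d ^+ 2) * M.
  rewrite /moment /M !mulr_sumr -big_split/=; apply: ler_sum => v _.
  have -> : (1 + d) * (m v * mdist z (f v) ^+ 2) + (d + d ^+ 2) * m v =
    m v * ((1 + d) * mdist z (f v) ^+ 2 + (d + d ^+ 2)) by ring.
  apply: ler_wpM2l => //.
  have := metric_triangle p z (f v); have := mdist_ge0 z (f v).
  have := mdist_ge0 p (f v).
  move: (mdist p (f v)) (mdist z (f v)) => x t x0 t0 tri.
  have xt : x <= t + d by lra.
  have : x ^+ 2 <= (t + d) ^+ 2 by rewrite ler_sqr ?nnegrE//; lra.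
  have := mulr_ge0 (ltW d0) (sqr_ge0 (t - 1)).
  rewrite sqrrB sqrrD expr1n; nra.
have : (1 + d) * moment z <= (1 + d) * (I + d) by rewrite ler_wpM2l//; lra.
have : d ^+ 2 <= d by rewrite expr2 ler_piMr// ltW.
have := MM; nra.
Qed.

End Barycenter.

Lemma CAT0_contract_between (R : realType) (Y : metricType R) (hY : CAT0_space Y)
    (p x y x' y' : Y) t : 0 <= t <= 1 ->
  mdist p x' = t * mdist p x -> mdist x' x = (1 - t) * mdist p x ->
  mdist p y' = t * mdist p y -> mdist y' y = (1 - t) * mdist p y ->
  mdist x' y' <= t * mdist x y.
Proof.
move=> /andP[t0 t1] px xx py yy.
have [c gc <-] := geodesic_through hY t0 t1 px xx.
have [c' gc' <-] := geodesic_through hY t0 t1 py yy.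
by rewrite px py; apply: CAT0_contract => //; apply/andP.
Qed.

Lemma common_pos_bound (R : realType) (V : finType) (t : V -> R) :
  (forall v, 0 < t v <= 1) -> exists2 r, 0 < r <= 1 & forall v, r <= t v.
Proof.
move=> ht; exists (\big[Num.min/1]_v t v).
  by rewrite bigmin_le_id andbT; apply: lt_bigmin => // v _; case/andP: (ht v).
by move=> v; exact: bigmin_le_cond.
Qed.

(** * Germs of geodesics and the cone coordinates at the barycenter *)

Section ConeEmbedding.
Variables (R : realType) (Y : cube_complex R).
Local Notation char a := (@char_map R Y a).
Implicit Types (a b : cell Y).
Hypothesis hY : CAT0_space Y.

Lemma gapped_point (p : Y) : exists2 e : R, 0 < e <= 1 &
  forall a v, cube v -> char a v = p -> gapped e v.
Proof.
have [a0 [v0 [hv0 cv0]]] := cc_cover p.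
have [e [e01 ge]] := gapped_exists v0; exists e => // a v hv cv.
by apply: (gapped_transfer hv0 hv _ ge); rewrite cv0.
Qed.

Section Germ.
Variables (p : Y) (e : R).
Hypothesis e01 : 0 < e <= 1.
Hypothesis gp : forall a v, cube v -> char a v = p -> gapped e v.

Lemma near_cell y : mdist p y < e -> exists a u v,
  [/\ cube u, cube v, char a v = p & char a u = y].
Proof.
move=> py; have [a0 [v0 [hv0 cv0]]] := cc_cover p.
have d0 : 0 < e - mdist p y by rewrite subr_gt0.
have [l s le] := cell_string_approx p y d0; rewrite addrC subrK in le.
have [|||||a [u [v [[hu hv] cv cu _ _]]]] :=
  @string_lip R Y p e e01 gp unit (fun _ _ => 0) (fun _ _ _ => tt) _ _ _ _ p y l s
    a0 v0 v0 hv0 hv0 cv0 cv0.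
- by [].
- by move=> *; rewrite addr0.
- by [].
- by move=> *; exact: eucl_dist_ge0.
- by rewrite eucl_distxx add0r.
by exists a, u, v.
Qed.

(** The start of the geodesic is a straight segment of one cell, described by its distances to [p]
    and [y] because these are what the comparison lemmas take. *)
Lemma geodesic_germ y T : 0 < T <= 1 -> T * mdist p y < e -> exists a u v,
  [/\ cube u, cube v, char a v = p, eucl_dist u v = T * mdist p y &
   forall s, 0 <= s <= 1 ->
     mdist p (char a (v + s *: (u - v))) = s * T * mdist p y /\
     mdist (char a (v + s *: (u - v))) y = (1 - s * T) * mdist p y].
Proof.
move=> /andP[T0 T1] Te; have [gs _] := hY; have [c gc] := gs p y.
have D0 := mdist_ge0 p y.
have TD : 0 <= T * mdist p y <= mdist p y.
  by apply/andP; split; [exact: mulr_ge0 (ltW T0) D0|exact: ler_piMl].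
have [d1 d2] := geodesic_dist0 gc TD.
have [|a [u [v [hu hv cv cu]]]] := @near_cell (c (T * mdist p y)).
  by rewrite d1.
have uv : eucl_dist u v = T * mdist p y.
  by rewrite -(cell_isometry hY)// cv cu metric_sym.
exists a, u, v; split=> // s s01.
have hs := segment_cube hv hu s01; have /andP[s0 s1] := s01.
have e1 : mdist p (char a (v + s *: (u - v))) = s * T * mdist p y.
  rewrite -cv (cell_isometry hY)// eucl_dist_scale ger0_norm//.
  by rewrite eucl_distC uv cv mulrA.
split=> //; apply/eqP; rewrite eq_le; apply/andP; split.
  apply: le_trans (metric_triangle _ (char a u) _) _.
  rewrite cu d2 -cu (cell_isometry hY)//.
  have {2}-> : u = v + 1 *: (u - v) by rewrite scale1r addrC subrK.
  rewrite eucl_dist_seg distrC ger0_norm ?subr_ge0// eucl_distC uv; lra.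
have := metric_triangle p (char a (v + s *: (u - v))) y.
rewrite e1; lra.
Qed.

End Germ.
End ConeEmbedding.

(** Convexity of the square for [y + (1 - k) * d = k * (y / k) + (1 - k) * d], multiplied by [k]. It
    turns a path that joins a geodesic to [f v] partway into an estimate of the squared distance to
    [f v]. *)
Lemma convex_sqr_le (R : realFieldType) (k x y d : R) : 0 < k <= 1 ->
  0 <= x -> 0 <= y -> 0 <= d -> x <= y + (1 - k) * d ->
  k * x ^+ 2 <= y ^+ 2 + k * (1 - k) * d ^+ 2.
Proof.
move=> /andP[k0 k1] x0 y0 d0 xy.
have k1' : 0 <= 1 - k by rewrite subr_ge0.
have h : x ^+ 2 <= (y + (1 - k) * d) ^+ 2.
  by rewrite ler_sqr ?nnegrE ?addr_ge0 ?mulr_ge0.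
have := ler_wpM2l (ltW k0) h; have := mulr_ge0 k1' (sqr_ge0 (y - k * d)).
by rewrite !(sqrrD, sqrrB); lra.
Qed.

Lemma le0_of_le_small (R : realFieldType) (t b k : R) : 0 < t -> 0 <= k ->
  (forall s, 0 < s <= t -> b <= s * k) -> b <= 0.
Proof.
move=> t0 k0 h; apply/ler_addgt0Pl => d d0; rewrite addr0.
have k1 : 0 < k + 1 by lra.
pose s := Num.min t (d / (k + 1)).
have s0 : 0 < s by rewrite lt_min t0 divr_gt0.
have sk : s * (k + 1) <= d by rewrite -ler_pdivlMr// ge_min lexx orbT.
have /h : 0 < s <= t by rewrite s0 ge_min lexx.
lra.
Qed.

Section ConeEmbedding.
Variables (R : realType) (Y : cube_complex R).
Local Notation char a := (@char_map R Y a).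
Hypothesis hY : CAT0_space Y.

(** Only the spokes of finitely many points are collected, so the target is finite-dimensional even
    if infinitely many edges leave [p]. *)
Lemma direction_family (p : Y) (e : R) (V : finType) (a : V -> cell Y)
    (u w : forall v, 'rV[R]_(cell_dim (a v))) :
  0 < e <= 1 -> (forall b x, cube x -> char b x = p -> gapped e x) ->
  (forall v, [/\ cube (u v), cube (w v) & char (a v) (w v) = p]) ->
  exists N (q : 'I_N -> Y), [/\ injective q, forall k, direction p e (q k) &
    forall v i, u v ord0 i != w v ord0 i ->
      exists k, q k = char (a v) (spoke e (u v) (w v) i)].
Proof.
move=> e01 gp huw.
pose Q := undup (flatten [seq [seq char (a v) (spoke e (u v) (w v) i) |
  i <- enum 'I_(cell_dim (a v)) & u v ord0 i != w v ord0 i] | v <- enum V]).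
exists (size Q), (fun k => tnth (in_tuple Q) k); split.
- by apply/tuple_uniqP; rewrite undup_uniq.
- move=> k; have : tnth (in_tuple Q) k \in Q by exact: mem_tnth.
  rewrite mem_undup => /flattenP[s /mapP[v _ ->]] /mapP[i].
  rewrite mem_filter => /andP[ui _] ->; have [hu hw cw] := huw v.
  by have [] := spoke_direction e01 gp hu hw cw ui.
- move=> v i ui; suff /tnthP[k hk] : char (a v) (spoke e (u v) (w v) i) \in in_tuple Q.
    by exists k; rewrite hk.
  rewrite mem_undup; apply/flattenP.
  eexists; first by apply: map_f; rewrite mem_enum.
  by apply/mapP; exists i => //; rewrite mem_filter ui mem_enum.
Qed.

(* p is the barycenter and phi the logarithm at p followed by the coordinates of
   the tangent cone.  The last inequality is the first variation of the moment
   in the directions of the points f w, the inner product of two directions at p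
   being at least 2 K - |xi| |zeta| for K the product of their coordinates. *)
Theorem cone_embedding (hYc : complete_space Y) (V : finType) (m : V -> R) (f : V -> Y) :
  (forall v, 0 <= m v) -> 0 < \sum_v m v ->
  exists p N (phi : V -> 'rV[R]_N),
    [/\ forall v w, eucl_dist (phi v) (phi w) <= mdist (f v) (f w),
        forall v, mdist p (f v) ^+ 2 <= dot (phi v) (phi v) &
        2 * \sum_v \sum_w m v * m w * dot (phi v) (phi w) <=
          (\sum_v m v * mdist p (f v)) ^+ 2].
Proof.
move=> m0 M0; have [p pmin] := barycenter_exists hY hYc f m0 M0.
have [e e01 gp] := gapped_point p; have /andP[e0 e1] := e01.
pose D v := mdist p (f v); have D0 v : 0 <= D v by exact: mdist_ge0.
(* One scale for all points: [T <= 1], and [T * D v < e / 4] is the radius required by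
   [components_lip]. *)
pose T := e / (4 * (1 + \sum_v D v) + 1).
have SD0 : 0 <= \sum_v D v by rewrite sumr_ge0.
have den0 : 0 < 4 * (1 + \sum_v D v) + 1 by lra.
have T0 : 0 < T by rewrite divr_gt0.
have T1 : T <= 1 by rewrite ler_pdivrMr// mul1r; lra.
have TD v : T * D v < e / 4.
  have Dv : D v <= \sum_v D v by rewrite (bigD1 v)//= lerDl sumr_ge0.
  have : T * (4 * (1 + \sum_v D v) + 1) = e by rewrite divfK// gt_eqF.
  have := ler_wpM2l (ltW T0) Dv; nra.
have T01 : 0 < T <= 1 by rewrite T0.
have [a [u [w huw]]] : exists (a : V -> cell Y) (u w : forall v, 'rV[R]_(cell_dim (a v))),
  forall v, [/\ cube (u v), cube (w v), char (a v) (w v) = p,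
      eucl_dist (u v) (w v) = T * D v &
    forall s, 0 <= s <= 1 ->
     mdist p (char (a v) (w v + s *: (u v - w v))) = s * T * D v /\
     mdist (char (a v) (w v + s *: (u v - w v))) (f v) = (1 - s * T) * D v].
  have /choice[r hr] v : exists r : {a : cell Y & ('rV[R]_(cell_dim a) * 'rV[R]_(cell_dim a))%type},
    let: existT a (u, w) := r in
    [/\ cube u, cube w, char a w = p, eucl_dist u w = T * D v &
     forall s, 0 <= s <= 1 ->
       mdist p (char a (w + s *: (u - w))) = s * T * D v /\
       mdist (char a (w + s *: (u - w))) (f v) = (1 - s * T) * D v].
    have [|a [u [w h]]] := geodesic_germ hY e01 gp (y := f v) T01.
      by apply: lt_le_trans (TD v) _; lra.
    by exists (existT _ a (u, w)).
  exists (fun v => projT1 (r v)), (fun v => (projT2 (r v)).1), (fun v => (projT2 (r v)).2).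
  by move=> v; have := hr v; case: (r v) => a [u w].
have hu v : cube (u v) by case: (huw v).
have hw v : cube (w v) by case: (huw v).
have cw v : char (a v) (w v) = p by case: (huw v).
have duw v : eucl_dist (u v) (w v) = T * D v by case: (huw v).
have dp v s : 0 <= s <= 1 ->
    mdist p (char (a v) (w v + s *: (u v - w v))) = s * T * D v by case: (huw v) => _ _ _ _ h /h[].
have df v s : 0 <= s <= 1 ->
    mdist (char (a v) (w v + s *: (u v - w v))) (f v) = (1 - s * T) * D v.
  by case: (huw v) => _ _ _ _ h /h[].
have [N [q [qi qd qc]]] := direction_family e01 gp (fun v => And3 (hu v) (hw v) (cw v)).
pose c v := components e q (u v) (w v).
have uE v : u v = w v + 1 *: (u v - w v) by rewrite scale1r addrC subrK.
have one01 : 0 <= (1 : R) <= 1 by rewrite ler01 lexx.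
(* Moving towards [p] by the ratio [T] contracts distances by [T], which the final rescaling by
   [T^-1] undoes. *)
have Lip v v' : eucl_dist (c v) (c v') <= T * mdist (f v) (f v').
  apply: le_trans (components_lip hY e01 gp qi qd (hu v) (hw v) (hu v') (hw v')
    (cw v) (cw v') _ _) _; [by rewrite duw|by rewrite duw|].
  apply: (CAT0_contract_between hY (p := p)); first by apply/andP; split=> //; exact: ltW.
  - by rewrite {1}uE dp// mul1r.
  - by rewrite {1}uE df// mul1r.
  - by rewrite {1}uE dp// mul1r.
  - by rewrite {1}uE df// mul1r.
have norm v : T ^+ 2 * D v ^+ 2 <= dot (c v) (c v).
  rewrite -exprMn -duw eucl_dist_sqr.
  by apply: (components_norm_ge hY e01 gp) => // i /qc.
pose M := \sum_v m v.
have var v' : \sum_v m v * (2 * dot (c v) (c v') - (T * D v) * (T * D v')) <= 0.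
  set beta := \sum_v _.
  have /choice[t0 ht0] v : exists t0 : R, 0 < t0 <= 1 /\ forall s t,
      0 <= s <= t0 -> 0 <= t <= t0 ->
      mdist (char (a v') (w v' + s *: (u v' - w v'))) (char (a v) (w v + t *: (u v - w v))) ^+ 2
      <= s ^+ 2 * (T * D v') ^+ 2 + t ^+ 2 * (T * D v) ^+ 2 -
        2 * s * t * (2 * dot (c v) (c v') - (T * D v) * (T * D v')).
    have [t0 t01 h] := cone_upper hY e01 gp qi qd (hu v') (hw v') (hu v) (hw v) (cw v') (cw v).
    exists t0; split=> // s t hs ht; apply: le_trans (h s t hs ht) _.
    by rewrite !duw -/(c v) -/(c v') (dotC (c v')) (mulrC (T * D v')).
  have [t /andP[tp t1] tle] := common_pos_bound (fun v => (ht0 v).1).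
  (* The barycenter is displaced by the parameter [s] towards [f v'] while [t] stays fixed.
     Minimality divided by [s] leaves an error of order [s]. *)
  have step s : 0 < s <= t -> 2 * t * beta <= s * ((T * D v') ^+ 2 * M).
    move=> /andP[s0 st].
    pose y := char (a v') (w v' + s *: (u v' - w v')).
    have one v : T * t * mdist y (f v) ^+ 2 <=
        T * t * D v ^+ 2 + s ^+ 2 * (T * D v') ^+ 2 -
        2 * s * t * (2 * dot (c v) (c v') - (T * D v) * (T * D v')).
      have [_ h] := ht0 v.
      have {h} := h s t _ _; rewrite (ltW s0) (ltW tp) !(le_trans st (tle v)) tle.
      move=> /(_ isT isT); rewrite -/y.
      set z := char (a v) _; set B := 2 * dot _ _ - _ => h.
      have t01 : 0 <= t <= 1 by rewrite ltW.
      have zf := df v t t01; rewrite -/z in zf.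
      have yz0 := mdist_ge0 y z.
      have tri : mdist y (f v) <= mdist y z + (1 - t * T) * D v.
        by rewrite -zf; exact: metric_triangle.
      have tT0 : 0 < t * T by exact: mulr_gt0.
      have tT1 : t * T <= 1 by nra.
      (* With [k = t * T] the terms in [t ^+ 2 * (T * D v) ^+ 2] cancel, so a fixed [t] gives a
         sharp first variation in [s]. *)
      have k0 : 0 < t * T <= 1 by rewrite tT0.
      have := convex_sqr_le k0 (mdist_ge0 y (f v)) yz0 (D0 v) tri.
      lra.
    have := @ler_sum _ _ (index_enum V) xpredT _ _ (fun v _ => ler_wpM2l (m0 v) (one v)).
    have -> : \sum_v m v * (T * t * mdist y (f v) ^+ 2) = T * t * moment m f y.
      by rewrite mulr_sumr; apply: eq_bigr => v _; ring.
    have -> : \sum_v m v * (T * t * D v ^+ 2 + s ^+ 2 * (T * D v') ^+ 2 -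
        2 * s * t * (2 * dot (c v) (c v') - T * D v * (T * D v'))) =
        T * t * moment m f p + s ^+ 2 * (T * D v') ^+ 2 * M - 2 * s * t * beta.
      rewrite /moment /M /beta !mulr_sumr -big_split/= -sumrB.
      by apply: eq_bigr => v _; rewrite -/(D v); ring.
    have := ler_wpM2l (ltW (mulr_gt0 T0 tp)) (pmin y).
    have -> : s * ((T * D v') ^+ 2 * M) = s^-1 * (s ^+ 2 * (T * D v') ^+ 2 * M).
      by field; rewrite gt_eqF.
    have -> : 2 * t * beta = s^-1 * (2 * s * t * beta) by field; rewrite gt_eqF.
    by move=> h1 h2; rewrite ler_pM2l ?invr_gt0//; lra.
  have K0 : 0 <= (T * D v') ^+ 2 * M by rewrite mulr_ge0 ?sqr_ge0 ?ltW.
  have := le0_of_le_small tp K0 step.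
  by rewrite pmulr_rle0// mulr_gt0.
exists p, N, (fun v => T^-1 *: c v); split.
- move=> v v'; rewrite eucl_distE -scalerBr dotZl dotZr mulrA -expr2 sqrtrM ?sqr_ge0//.
  rewrite sqrtr_sqr ger0_norm ?invr_ge0 ?(ltW T0)// -eucl_distE.
  by rewrite mulrC ler_pdivrMr// mulrC.
- move=> v; rewrite dotZl dotZr mulrA -expr2 exprVn mulrC ler_pdivlMr ?exprn_gt0//.
  by rewrite mulrC norm.
have : \sum_v' m v' * (\sum_v m v * (2 * dot (c v) (c v') - (T * D v) * (T * D v'))) <= 0.
  by apply: sumr_le0 => v' _; rewrite mulr_ge0_le0.
have -> : \sum_v' m v' * (\sum_v m v * (2 * dot (c v) (c v') - (T * D v) * (T * D v'))) =
  T ^+ 2 * (2 * \sum_v \sum_w m v * m w * dot (T^-1 *: c v) (T^-1 *: c w) -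
   (\sum_v m v * D v) ^+ 2).
  rewrite expr2 [(\sum_v m v * D v) ^+ 2]expr2 mulr_suml mulr_sumr -sumrB mulr_sumr.
  apply: eq_bigr => v _; rewrite mulr_sumr mulr_sumr [X in _ - X]mulr_sumr -sumrB mulr_sumr.
  apply: eq_bigr => v' _; rewrite dotZl dotZr (dotC (c v')).
  by field; rewrite gt_eqF.
by rewrite pmulr_rle0 ?exprn_gt0// subr_le0.
Qed.

End ConeEmbedding.

(** * Poincare inequality and counting *)

Section Poincare.
Variables (R : realType) (G : graph).
Local Notation dg v := ((deg v)%:R : R).
Local Notation M := (\sum_(v : G) dg v).

Lemma edge_sum_ge0 (f : G -> G -> R) : (forall u v, 0 <= f u v) -> 0 <= edge_sum f.
Proof. by move=> f0; rewrite mulr_ge0// !sumr_ge0// => u _; rewrite sumr_ge0. Qed.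

Lemma ler_edge_sum (f g : G -> G -> R) :
  (forall u v, adj u v -> f u v <= g u v) -> edge_sum f <= edge_sum g.
Proof.
by move=> fg; rewrite ler_wpM2l// ler_sum// => u _; rewrite ler_sum// => v /fg.
Qed.

Lemma edge_sum_const (c : R) : edge_sum (fun _ _ : G => c) = c * M / 2.
Proof.
rewrite /edge_sum mulrC; congr (_ / 2); rewrite mulr_sumr; apply: eq_bigr => u _.
by rewrite sumr_const mulr_natr; congr (_ *+ _); exact: eq_card.
Qed.

Lemma sum_deg : 2 * num_edges R G = M.
Proof. by rewrite /num_edges edge_sum_const mul1r mulrC divfK. Qed.

Lemma poincare (lambda : R) (psi : G -> R) : (lambda%:E <= lambda1 R G)%E -> 0 < M ->
  lambda * (\sum_v dg v * psi v ^+ 2 - (\sum_v dg v * psi v) ^+ 2 / M) <=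
  edge_sum (fun u v => (psi u - psi v) ^+ 2).
Proof.
move=> hl M0.
have eE : edge_sum (fun u v => (psi u - psi v) ^+ 2) =
    edge_sum (fun u v => `|psi u - psi v| ^+ 2).
  by congr (_ * _); apply: eq_bigr => u _; apply: eq_bigr => v _; rewrite real_normK ?num_real.
have E0 : 0 <= edge_sum (fun u v => (psi u - psi v) ^+ 2).
  by apply: edge_sum_ge0 => *; exact: sqr_ge0.
have wm : wmean psi = (\sum_v dg v * psi v) / M.
  rewrite /wmean sum_deg mulr_suml; apply: eq_bigr => v _; ring.
have var : \sum_v dg v * `|psi v - wmean psi| ^+ 2 =
    \sum_v dg v * psi v ^+ 2 - (\sum_v dg v * psi v) ^+ 2 / M.
  have -> w : \sum_v dg v * `|psi v - w| ^+ 2 =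
      \sum_v dg v * psi v ^+ 2 - 2 * w * (\sum_v dg v * psi v) + w ^+ 2 * M.
    rewrite !mulr_sumr -sumrB -big_split/=; apply: eq_bigr => v _.
    by rewrite real_normK ?num_real//; ring.
  by rewrite wm; field; rewrite gt_eqF.
(* The infimum in [lambda1] ranges over nonconstant functions; for a constant one the variance is
   0. *)
have [[u [v uv]]|cst] := pselect (exists u v, psi u <> psi v).
  have : lambda <= rayleigh psi.
    rewrite -lee_fin; apply: le_trans hl _; apply: ereal_inf_lbound.
    by exists psi => //; exists u, v.
  rewrite /rayleigh var -eE; set S := _ - _ / M.
  have S0 : 0 <= S.
    by rewrite /S -var sumr_ge0// => w _; rewrite mulr_ge0// sqr_ge0.
  have [->|Sn] := eqVneq S 0; first by rewrite mulr0.
  by rewrite ler_pdivlMr// lt_def Sn.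
suff -> : \sum_v dg v * psi v ^+ 2 - (\sum_v dg v * psi v) ^+ 2 / M = 0 by rewrite mulr0.
have [v0 _|V0] := pickP (@predT G); last by move: M0; rewrite big_pred0// ltxx.
have pc v : psi v = psi v0.
  by apply/eqP/negPn/negP => /eqP h; apply: cst; exists v, v0.
have -> : \sum_v dg v * psi v ^+ 2 = M * psi v0 ^+ 2.
  by rewrite mulr_suml; apply: eq_bigr => v _; rewrite (pc v).
have -> : \sum_v dg v * psi v = M * psi v0.
  by rewrite mulr_suml; apply: eq_bigr => v _; rewrite (pc v).
by field; rewrite gt_eqF.
Qed.

Lemma poincare_vector (lambda : R) N (phi : G -> 'rV[R]_N) :
  (lambda%:E <= lambda1 R G)%E -> 0 < M ->
  lambda * (\sum_v dg v * dot (phi v) (phi v) -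
            (\sum_v \sum_w dg v * dg w * dot (phi v) (phi w)) / M) <=
  edge_sum (fun u v => eucl_dist (phi u) (phi v) ^+ 2).
Proof.
move=> hl M0.
have -> : edge_sum (fun u v => eucl_dist (phi u) (phi v) ^+ 2) =
    \sum_(k < N) edge_sum (fun u v => (phi u ord0 k - phi v ord0 k) ^+ 2).
  rewrite /edge_sum -mulr_sumr; congr (_ * _).
  rewrite exchange_big/=; apply: eq_bigr => u _.
  rewrite exchange_big/=; apply: eq_bigr => v _.
  by rewrite eucl_dist_sqr; apply: eq_bigr => k _; rewrite !mxE expr2.
have -> : \sum_v dg v * dot (phi v) (phi v) =
    \sum_(k < N) \sum_v dg v * phi v ord0 k ^+ 2.
  rewrite exchange_big/=; apply: eq_bigr => v _; rewrite mulr_sumr.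
  by apply: eq_bigr => k _; rewrite expr2.
have -> : \sum_v \sum_w dg v * dg w * dot (phi v) (phi w) =
    \sum_(k < N) (\sum_v dg v * phi v ord0 k) ^+ 2.
  under [RHS]eq_bigr do rewrite expr2 mulr_suml.
  rewrite [RHS]exchange_big/=; apply: eq_bigr => v _.
  under [RHS]eq_bigr do rewrite mulr_sumr.
  rewrite [RHS]exchange_big/=; apply: eq_bigr => w _.
  by rewrite mulr_sumr; apply: eq_bigr => k _; ring.
rewrite mulr_suml -sumrB mulr_sumr; apply: ler_sum => k _.
exact: poincare.
Qed.

Lemma weighted_CS (D : G -> R) :
  (\sum_v dg v * D v) ^+ 2 <= M * \sum_v dg v * D v ^+ 2.
Proof.
set S := \sum_v dg v * D v.
have M0 : 0 <= M by rewrite sumr_ge0.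
have [Mz|Mn] := eqVneq M 0.
  suff -> : S = 0 by rewrite Mz mul0r expr0n.
  apply: big1 => v _; move/eqP: Mz; rewrite psumr_eq0// => /allP/(_ v (mem_index_enum _))/=.
  by move=> /eqP ->; rewrite mul0r.
have Mp : 0 < M by rewrite lt_def Mn.
have : 0 <= \sum_v dg v * (M * D v - S) ^+ 2.
  by rewrite sumr_ge0// => v _; rewrite mulr_ge0// sqr_ge0.
have -> : \sum_v dg v * (M * D v - S) ^+ 2 =
    M * (M * \sum_v dg v * D v ^+ 2 - S ^+ 2).
  have -> x y : \sum_v dg v * (x * D v - y) ^+ 2 =
      x ^+ 2 * (\sum_v dg v * D v ^+ 2) - 2 * x * y * (\sum_v dg v * D v) + y ^+ 2 * M.
    by rewrite !mulr_sumr -sumrB -big_split/=; apply: eq_bigr => v _; ring.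
  by rewrite -/S; ring.
by rewrite pmulr_rge0// subr_ge0.
Qed.

Theorem cube_complex_poincare (Y : cube_complex R) (f : G -> Y) (lambda : R) :
  CAT0_space Y -> complete_space Y -> (lambda%:E <= lambda1 R G)%E -> 0 < lambda ->
  0 < M -> exists p, lambda / 2 * \sum_v dg v * mdist p (f v) ^+ 2 <=
    edge_sum (fun u v => mdist (f u) (f v) ^+ 2).
Proof.
move=> hY hYc hl l0 M0.
have [p [N [phi [lip nrm bar]]]] := cone_embedding hY hYc f (fun v => ler0n R (deg v)) M0.
exists p.
apply: le_trans (_ : edge_sum (fun u v => eucl_dist (phi u) (phi v) ^+ 2) <= _); last first.
  by apply: ler_edge_sum => u v _; rewrite ler_sqr ?nnegrE ?eucl_dist_ge0 ?mdist_ge0.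
apply: le_trans (poincare_vector phi hl M0).
rewrite -mulrA ler_pM2l//.
have := weighted_CS (fun v => mdist p (f v)); move: bar.
have : \sum_v dg v * mdist p (f v) ^+ 2 <= \sum_v dg v * dot (phi v) (phi v).
  by apply: ler_sum => v _; rewrite ler_wpM2l.
set Q := \sum_v _ * mdist _ _ ^+ 2; set B := \sum_v \sum_w _; set S := \sum_v _ * mdist _ _.
move=> h1 h2 h3.
(* Indeed [2 * B <= S ^+ 2 <= M * Q]. *)
suff : B / M <= Q / 2 by lra.
by rewrite ler_pdivrMr//; lra.
Qed.

End Poincare.

Section Counting.
Variable G : graph.

Fixpoint gball (k : nat) (x : G) : {set G} :=
  if k is k'.+1 then \bigcup_(z in gball k' x) [set w | (w == z) || adj z w]
  else [set x].

Lemma card_gball d k x : (forall v : G, (deg v <= d)%N) -> (#|gball k x| <= d.+1 ^ k)%N.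
Proof.
move=> hd; elim: k => [|k IH]; first by rewrite /= cards1.
have cU : (#|gball k.+1 x| <= \sum_(z in gball k x) d.+1)%N.
  rewrite /=; elim/big_rec2: _ => [|z n S _ h]; first by rewrite cards0.
  rewrite (leq_trans (leq_card_setU _ _))// leq_add//.
  have -> : ([set w | (w == z) || adj z w] = z |: [set w | adj z w])%SET.
    by apply/setP => w; rewrite !inE.
  apply: leq_trans (leq_card_setU _ _) _; rewrite cards1 add1n ltnS.
  by apply: leq_trans (hd z); rewrite /deg cardsE.
by apply: leq_trans cU _; rewrite sum_nat_const expnSr leq_mul2r.
Qed.

Lemma gball_path x s k : path (@adj G) x s -> (size s <= k)%N -> last x s \in gball k x.
Proof.
elim: k s => [|k IH] s ps; first by rewrite leqn0 => /nilP -> /=; rewrite inE.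
case/lastP: s ps => [_ _|s y].
  by apply/bigcupP; exists x; [exact: (IH [::])|rewrite inE eqxx].
rewrite rcons_path size_rcons last_rcons ltnS => /andP[ps e] sk.
by apply/bigcupP; exists (last x s); [exact: IH|rewrite inE e orbT].
Qed.

End Counting.

Section PathDist.
Variables (R : realType) (G : graph).
Hypothesis Gc : connected_graph G.

Lemma path_dist_ge0 (x y : G) : 0 <= path_dist R x y.
Proof.
have /connectP[s ps ->] := Gc x y.
by apply: lb_le_inf => [|_ [t _ <-]//]; exists (size s)%:R, s.
Qed.

Lemma path_dist_adj (x y : G) : adj x y -> path_dist R x y <= 1.
Proof.
move=> xy; apply: ge_inf; first by exists 0 => _ [t _ <-].
by exists [:: y] => //=; rewrite xy.
Qed.

Lemma path_dist_lt_gball (x y : G) (k : nat) : path_dist R x y < k%:R -> y \in gball k x.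
Proof.
move=> xyk; have [s [ps <-] sk] : exists2 s, path (@adj G) x s /\ last x s = y & (size s <= k)%N.
  apply: contrapT => h; move: xyk; apply/negP; rewrite -leNgt.
  have /connectP[s ps e] := Gc x y.
  apply: lb_le_inf; first by exists (size s)%:R, s.
  move=> _ [t [pt lt] <-]; rewrite ler_nat leqNgt; apply/negP => tk.
  by apply: h; exists t => //; exact: ltnW.
exact: gball_path.
Qed.

Lemma deg_gt0 (v : G) : (1 < #|G|)%N -> (0 < deg v)%N.
Proof.
move=> G1; have [w wv] : exists w, w != v.
  apply: contrapT => h; suff : (#|G| <= 1)%N by rewrite leqNgt G1.
  rewrite -(card1 v); apply: subset_leq_card; apply/fintype.subsetP => w _; rewrite inE.
  by apply/negPn/negP => wv; apply: h; exists w.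
have /connectP[[|z s] /= ps e] := Gc v w; first by rewrite e eqxx in wv.
by case/andP: ps => vz _; apply/card_gt0P; exists z.
Qed.

End PathDist.

(** Markov's inequality: the weighted total is at most [K * d * #|V|], and the threshold exceeds
    [2 * d * K], so at most half of the vertices lie above it. *)
Lemma markov_half (R : realType) (V : finType) (m : V -> R) (g : V -> R) (K d : R) :
  (forall v, 1 <= m v <= d) -> (forall v, 0 <= g v) -> 0 <= K ->
  \sum_v m v * g v <= K * \sum_v m v ->
  #|V|%:R <= 2 * #|[pred v | g v <= 2 * d * K + 1]|%:R :> R.
Proof.
move=> hm g0 K0 hK; set T := 2 * d * K + 1.
have [v0 _|V0] := pickP (@predT V); last by rewrite eq_card0// mulr_ge0.
have d1 : 1 <= d by case/andP: (hm v0) => /le_trans h /h.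
have T0 : 0 < T by rewrite /T; have : 0 <= d * K by [rewrite mulr_ge0//; lra]; lra.
pose c v : R := (g v <= T)%R%:R.
have cE : \sum_v c v = #|[pred v | g v <= T]|%:R.
  rewrite -sum1_card natr_sum [RHS]big_mkcond/=; apply: eq_bigr => v _.
  by rewrite /c inE; case: ifP.
have one v : T * (1 - c v) <= m v * g v.
  have /andP[m1 _] := hm v; rewrite /c; case: (Order.TotalTheory.leP (g v) T) => h /=.
    by rewrite subrr mulr0 mulr_ge0//; lra.
  rewrite subr0 mulr1; apply: le_trans (ltW h) _.
  by rewrite ler_peMl.
have := @ler_sum _ _ (index_enum V) xpredT _ _ (fun v _ => one v).
rewrite -mulr_sumr sumrB cE sumr_const.
have Vd : \sum_v m v <= d * #|V|%:R.
  rewrite mulr_natr -sumr_const; apply: ler_sum => v _; by case/andP: (hm v).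
have h3 := ler_wpM2l K0 Vd.
set A := #|[pred v | _]|%:R; set n : R := #|_|%:R => h1.
have h2 : T * (n - A) <= K * (d * n) by apply: le_trans h1 (le_trans hK h3).
have A0 : 0 <= A by exact: ler0n.
have n0 : 0 <= n by exact: ler0n.
rewrite leNgt; apply/negP => An.
have nA : n / 2 < n - A by lra.
have : T * (n / 2) < T * (n - A) by rewrite ltr_pM2l.
rewrite {1}/T; lra.
Qed.

Theorem corollary1p9 (R : realType) (Y : cube_complex R) (G : nat -> graph)
    (hY : CAT0_space Y) (hYc : complete_space Y) (hG : expanders R G) :
  ~ exists f : forall n : nat, G n -> Y,
      uniform_embedding (fun n : nat => @path_dist R (G n)) f.
Proof.
move=> [f [rho1 [rho2 [[_ r1m r1u] [r20 r2m _] emb]]]].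
case: hG => Gc Ginf [d hd] [lambda l0 hl].
pose r := rho2 1; have rr0 : 0 <= r by exact: r20.
(* Adjacent vertices have images within [r], so the Poincare inequality bounds the weighted mean of
   the squared distances to [p] by [K]; the 1/2 of the edge sum cancels that of [lambda / 2]. *)
pose K := r ^+ 2 / lambda.
have K0 : 0 <= K by rewrite divr_ge0 ?sqr_ge0 ?ltW.
pose T := Num.sqrt (2 * d%:R * K + 1).
(* Images within [T] of [p] are at most [2 * T] apart, so their vertices are at graph distance below
   [t]. *)
have [t t0 tT] := r1u (2 * T).
have [k tk] : exists k : nat, t < k%:R.
  by exists (Num.truncn t).+1; case/andP: (truncn_itv t0).
(* [d.+1 ^ k] bounds a ball of radius [k], which is to contain half of the vertices. The extra 1
   ensures two vertices, hence positive degrees. *)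
have [n nbig] : exists n, (2 * d.+1 ^ k + 1 < #|G n|)%N.
  have [n0 _ h] := (cvgnyPgt _).1 Ginf (2 * d.+1 ^ k + 1)%N.
  by exists n0; apply: h => /=.
have n1 : (1 < #|G n|)%N by apply: leq_ltn_trans nbig; rewrite addn1.
have dg0 v : (0 < @deg (G n) v)%N by exact: deg_gt0.
have mb v : (1 : R) <= (@deg (G n) v)%:R <= (d%:R : R) by rewrite ler1n ler_nat dg0 hd.
have M0 : 0 < \sum_(v : G n) (deg v)%:R :> R.
  have [v _|V0] := pickP (@predT (G n)); last by move: n1; rewrite eq_card0.
  by rewrite (bigD1 v)//= ltr_pwDl ?ltr0n ?sumr_ge0.
have [p hp] := cube_complex_poincare (f n) hY hYc (hl n) l0 M0.
have E : edge_sum (fun u v => mdist (f n u) (f n v) ^+ 2) <= r ^+ 2 * (\sum_(v : G n) (deg v)%:R) / 2.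
  rewrite -edge_sum_const; apply: ler_edge_sum => u v uv.
  rewrite ler_sqr ?nnegrE ?mdist_ge0//.
  have /andP[_ h] := emb n u v; apply: le_trans h _; apply: r2m.
    exact: path_dist_ge0.
  exact: path_dist_adj.
have mom : \sum_(v : G n) (deg v)%:R * mdist p (f n v) ^+ 2 <= K * \sum_(v : G n) (deg v)%:R.
  have := le_trans hp E; rewrite /K [lambda / 2 * _]mulrAC ler_pdivrMr// divfK//.
  by rewrite [_ / lambda * _]mulrAC ler_pdivlMr// mulrC.
have := markov_half mb (fun v => sqr_ge0 (mdist p (f n v))) K0 mom.
set A := [pred v | _] => cA.
have [x xA|A0] := pickP A; last first.
  by move: cA; rewrite (eq_card0 A0) mulr0 lern0 => /eqP z; rewrite z in n1.
have dT v : v \in A -> mdist p (f n v) <= T.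
  rewrite inE => h; rewrite -[leLHS]ger0_norm ?mdist_ge0// -sqrtr_sqr ler_wsqrtr//.
have AB : (#|A| <= #|gball k x|)%N.
  apply: subset_leq_card; apply/fintype.subsetP => y yA.
  apply: (path_dist_lt_gball (R := R) (Gc n)); apply: lt_trans tk.
  rewrite ltNge; apply/negP => tle.
  have := r1m _ _ t0 tle; have /andP[h _] := emb n x y.
  have := metric_triangle (f n x) p (f n y); have := dT _ xA; have := dT _ yA.
  rewrite (metric_sym (f n x) p); lra.
have : (#|G n| <= 2 * d.+1 ^ k)%N.
  rewrite -(ler_nat R); apply: le_trans cA _; rewrite natrM ler_wpM2l// ler_nat.
  exact: leq_trans AB (card_gball _ _ (hd n)).
by rewrite leqNgt (leq_trans _ nbig)// addn1 ltnS leqnSn.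
Qed.
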